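(* Suppose that the basic regularity assumptions on $f,\psi_\ell,\phi_\ell$ and the quadratic majorization assumption (both stated in the context) hold. Let $(\mathbf{x}^k)_{k\in\mathbb{N}}$ be a sequence generated by the algorithm CO-BC-FB described in the context, and suppose that: (a) every block is updated at least once in each outer iteration, i.e. $\bigcup_{i=0}^{I_k-1}J_i^k=\{1,\dots,L\}$ for all $k$; (b) there is $\bar I\in\mathbb{N}^*$ with $0<I_k\le\bar I$ for all $k$; (c) $\Psi$ is bounded from below and the iterates generated by the algorithm (outer and inner) are bounded; (d) $\Psi$ satisfies the Kurdyka-Łojasiewicz property at every $\mathbf{x}\in\operatorname{dom}\Psi$. Then: (i) $(\mathbf{x}^k)_{k\in\mathbb{N}}$ has finite length, i.e. $\sum_{k=0}^{+\infty}\|\mathbf{x}^{k+1}-\mathbf{x}^k\|<+\infty$. (ii) $(\mathbf{x}^k)_{k\in\mathbb{N}}$ converges to a critical point $\widehat{\mathbf{x}}$ of $\Psi$, i.e. $0\in\partial\Psi(\widehat{\mathbf{x}})$.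
   Context: Setting. $\mathcal{H}=\mathcal{H}_1\times\dots\times\mathcal{H}_L$ is the direct sum of finite-dimensional real Hilbert spaces, $\mathbf{x}=(x_1,\dots,x_L)$, $\|\mathbf{x}\|^2=\sum_\ell\|x_\ell\|^2$. The objective is $\Psi=f+g$ with $g(\mathbf{x})=\sum_{\ell=1}^L\phi_\ell(\psi_\ell(x_\ell))$. $\nabla_\ell f$ is the gradient with respect to block $\ell$. $\partial$ is the limiting (Mordukhovich) subdifferential (equal to the usual subdifferential for convex functions). Basic regularity assumptions. $f$ is continuously differentiable on $\mathcal H$ and there are $\beta_{\ell,j}>0$ with $\|\nabla_\ell f(\mathbf{x}+(0,\dots,0,v_j,0,\dots,0))-\nabla_\ell f(\mathbf{x})\|\le\beta_{\ell,j}\|v_j\|$ for all $\ell,j$, $\mathbf{x}\in\mathcal{H}$, $v_j\in\mathcal{H}_j$. For each $\ell$: $\psi_\ell:\mathcal{H}_\ell\to[0,+\infty]$ is convex, proper, lower semicontinuous and Lipschitz continuous on its domain; $\phi_\ell:[0,+\infty]\to(-\infty,+\infty]$ is concave, strictly increasing and differentiable on $[0,+\infty)$, with $\phi_\ell'$ locally Lipschitz continuous on its domain. Quadratic majorization assumption. For every $\mathbf{y}\in\mathcal{H}$ and $J\subseteq\{1,\dots,L\}$ there are symmetric positive definite operators $A_{\mathbf y,\ell}$ on $\mathcal{H}_\ell$, $\ell\in J$ (possibly depending on $J$), such that for every $x=(x_\ell)_{\ell\in J}$, with $f(x\mid y_{\overline J})$ denoting the value of $f$ when blocks in $J$ are $x_\ell$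 and the other blocks are $y_\ell$, $$f(x\mid y_{\overline{J}})\le f(\mathbf{y})+\sum_{\ell\in J}\Big(\langle x_\ell-y_\ell,\nabla_\ell f(\mathbf{y})\rangle+\tfrac12\langle x_\ell-y_\ell,A_{\mathbf y,\ell}(x_\ell-y_\ell)\rangle\Big),$$ and there are constants $\underline\nu,\overline\nu>0$, independent of $\mathbf{y}$ and $J$, with $\underline\nu\,\mathrm{Id}\preceq A_{\mathbf y,\ell}\preceq\overline\nu\,\mathrm{Id}$. Algorithm CO-BC-FB. Fix $\delta>0$, $\mu>0$, and $\mathbf{x}^0\in\operatorname{dom}g$ with $\psi_\ell(x^0_\ell)<+\infty$ for all $\ell$. For $k=0,1,\dots$: set $\lambda_{\ell,k}=\phi_\ell'(\psi_\ell(x_\ell^k))$ and $\tilde{\mathbf{x}}_0^k=\mathbf{x}^k$. For $i=0,\dots,I_k-1$, given a set $J_i^k\subseteq\{1,\dots,L\}$ of blocks to update, put $\tilde x_{i+1,\ell}^k=\tilde x_{i,\ell}^k$ for $\ell\notin J_i^k$, and for each $\ell\in J_i^k$, with $A_{i,\ell}^k$ the operator $A_{\mathbf{y},\ell}$ of the quadratic majorization assumption at $\mathbf{y}=\tilde{\mathbf{x}}_i^k$, $J=J_i^k$, and $\|u\|_A^2=\langle u,Au\rangle$, find $\tilde x_{i+1,\ell}^k$, $\alpha_i\ge\frac12+\delta$ and $\tilde v_\ell^k(\tilde x_{i+1,\ell}^k)\in\partial\psi_\ell(\tilde x_{i+1,\ell}^k)$ such that $$\lambda_{\ell,k}\psi_\ell(\tilde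 x_{i+1,\ell}^k)+\langle\nabla_\ell f(\tilde{\mathbf{x}}_i^k),\tilde x_{i+1,\ell}^k-\tilde x_{i,\ell}^k\rangle+\alpha_i\|\tilde x_{i+1,\ell}^k-\tilde x_{i,\ell}^k\|_{A_{i,\ell}^k}^2\le\lambda_{\ell,k}\psi_\ell(\tilde x_{i,\ell}^k),$$ $$\|\nabla_\ell f(\tilde{\mathbf{x}}_i^k)+\lambda_{\ell,k}\tilde v_\ell^k(\tilde x_{i+1,\ell}^k)\|\le\mu\|\tilde x_{i+1,\ell}^k-\tilde x_{i,\ell}^k\|_{A_{i,\ell}^k}.$$ Then set $\mathbf{x}^{k+1}=\tilde{\mathbf{x}}_{I_k}^k$. Kurdyka-Łojasiewicz (KŁ) property of $\Psi$ at $\tilde{\mathbf{u}}$: there exist $\eta\in(0,+\infty]$, a neighborhood $U$ of $\tilde{\mathbf{u}}$ and a concave continuous $\varphi:[0,\eta)\to[0,+\infty)$ with $\varphi(0)=0$, $\varphi$ of class $C^1$ on $(0,\eta)$ and $\varphi'>0$ there, such that for all $\mathbf{u}\in U$ with $\Psi(\tilde{\mathbf{u}})<\Psi(\mathbf{u})<\Psi(\tilde{\mathbf{u}})+\eta$ one has $\varphi'(\Psi(\mathbf{u})-\Psi(\tilde{\mathbf{u}}))\,\mathrm{dist}(0,\partial\Psi(\mathbf{u}))\ge1$. *)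

(* Defs.v *)
From HB Require Import structures.
From mathcomp Require Import all_boot all_order all_algebra.
From mathcomp Require Import all_classical all_reals all_analysis.

Set Implicit Arguments.
Unset Strict Implicit.
Unset Printing Implicit Defensive.

From mathcomp Require Import ring lra.

Import Order.TTheory GRing.Theory Num.Theory.
Import numFieldNormedType.Exports.

Local Open Scope classical_set_scope.
Local Open Scope ring_scope.

(* Finite-dimensional real Hilbert spaces: completeness is automatic.         *)
HB.mixin Record NormedVect_isHilbert (R : realType) V
    & NormedModule R V & Vector R V := {
  inner : V -> V -> R;
  innerC : forall u v, inner u v = inner v u;
  innerDl : forall u v w, inner (u + v) w = inner u w + inner v w;
  innerZl : forall (a : R) u v, inner (a *: u) v = a * inner u v;
  sqr_norm_inner : forall u, `|u| ^+ 2 = inner u u;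
}.

#[short(type="finHilbertType")]
HB.structure Definition FinHilbert (R : realType) :=
  {V of NormedModule R V & Vector R V & NormedVect_isHilbert R V}.

Section InnerTheory.
Context {R : realType} {V : finHilbertType R}.
Implicit Types u v w : V.

Lemma innerDr u v w : inner u (v + w) = inner u v + inner u w.
Proof. by rewrite innerC innerDl !(innerC u). Qed.

Lemma innerZr (a : R) u v : inner u (a *: v) = a * inner u v.
Proof. by rewrite innerC innerZl innerC. Qed.

Lemma innerBl u v w : inner (u - v) w = inner u w - inner v w.
Proof. by rewrite innerDl -scaleN1r innerZl mulN1r. Qed.

Lemma inner_ge0 u : 0 <= inner u u.
Proof. by rewrite -sqr_norm_inner sqr_ge0. Qed.

Lemma inner_eq0 u : inner u u = 0 -> u = 0.
Proof. by rewrite -sqr_norm_inner => /eqP; rewrite sqrf_eq0 normr_eq0 => /eqP. Qed.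

Lemma inner_is_linear u : linear (inner u : V -> R^o).
Proof. by move=> a v w; rewrite innerDr innerZr. Qed.

HB.instance Definition _ u :=
  GRing.isLinear.Build R V R^o _ (inner u : V -> R^o) (inner_is_linear u).

Lemma riesz (phi : {linear V -> R^o}) : exists u, phi =1 inner u.
Proof.
pose F u : 'Hom(V, R^o) := linfun (inner u : V -> R^o).
have Flin : linear F.
  move=> a u v; apply/lfunP => w.
  by rewrite add_lfunE scale_lfunE !lfunE /= innerDl innerZl.
pose FL := GRing.isLinear.Build R V 'Hom(V, R^o) _ F Flin.
pose F' : {linear V -> 'Hom(V, R^o)} := HB.pack F FL.
pose G := linfun F'.
have kG : lker G == 0%VS.
  apply/lker0P => u v; rewrite !lfunE /= => Fuv.
  apply/eqP; rewrite -subr_eq0; apply/eqP; apply: inner_eq0.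
  have /lfunP/(_ (u - v)) : F u = F v by [].
  by rewrite !lfunE /= innerBl => ->; rewrite subrr.
have Gfull : limg G = fullv.
  apply/eqP; rewrite eqEdim subvf /= limg_dim_eq ?(eqP kG) ?capv0//.
  by rewrite !dimvf /dim /= muln1.
have : linfun phi \in limg G by rewrite Gfull memvf.
move=> /memv_imgP[u _ phiu]; exists u => v.
by have /lfunP/(_ v) := phiu; rewrite !lfunE.
Qed.

End InnerTheory.

Section DirectSum.
Context {R : realType} {L : nat}.

Definition dirsum (H : 'I_L -> finHilbertType R) : Type := forall l, H l.

Variable H : 'I_L -> finHilbertType R.
Implicit Types x y : dirsum H.

HB.instance Definition _ := gen_eqMixin (dirsum H).
HB.instance Definition _ := gen_choiceMixin (dirsum H).

Definition dirsum_add x y : dirsum H := fun l => x l + y l.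
Definition dirsum_opp x : dirsum H := fun l => - x l.
Definition dirsum_zero : dirsum H := fun l => 0.
Definition dirsum_scale (a : R) x : dirsum H := fun l => a *: x l.

Fact dirsum_addA : associative dirsum_add.
Proof. by move=> x y z; apply: functional_extensionality_dep => l; apply: addrA. Qed.
Fact dirsum_addC : commutative dirsum_add.
Proof. by move=> x y; apply: functional_extensionality_dep => l; apply: addrC. Qed.
Fact dirsum_add0 : left_id dirsum_zero dirsum_add.
Proof. by move=> x; apply: functional_extensionality_dep => l; apply: add0r. Qed.
Fact dirsum_addN : left_inverse dirsum_zero dirsum_opp dirsum_add.
Proof. by move=> x; apply: functional_extensionality_dep => l; apply: addNr. Qed.

HB.instance Definition _ := GRing.isZmodule.Build (dirsum H)
  dirsum_addA dirsum_addC dirsum_add0 dirsum_addN.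

Fact dirsum_scaleA a b x :
  dirsum_scale a (dirsum_scale b x) = dirsum_scale (a * b) x.
Proof. by apply: functional_extensionality_dep => l; apply: scalerA. Qed.
Fact dirsum_scale1 : left_id 1 dirsum_scale.
Proof. by move=> x; apply: functional_extensionality_dep => l; apply: scale1r. Qed.
Fact dirsum_scaleDr : right_distributive dirsum_scale +%R.
Proof. by move=> a x y; apply: functional_extensionality_dep => l; apply: scalerDr. Qed.
Fact dirsum_scaleDl x : {morph dirsum_scale^~ x : a b / a + b}.
Proof. by move=> a b; apply: functional_extensionality_dep => l; apply: scalerDl. Qed.

HB.instance Definition _ := GRing.Zmodule_isLmodule.Build R (dirsum H)
  dirsum_scaleA dirsum_scale1 dirsum_scaleDr dirsum_scaleDl.

Definition dirsum_inner x y : R := \sum_l inner (x l) (y l).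
Definition dirsum_norm x : R := Num.sqrt (\sum_l `|x l| ^+ 2).

Lemma dirsum_innerC x y : dirsum_inner x y = dirsum_inner y x.
Proof. by apply: eq_bigr => l _; apply: innerC. Qed.
Lemma dirsum_innerDl x y z :
  dirsum_inner (x + y) z = dirsum_inner x z + dirsum_inner y z.
Proof. by rewrite -big_split; apply: eq_bigr => l _; apply: innerDl. Qed.
Lemma dirsum_innerZl a x y : dirsum_inner (a *: x) y = a * dirsum_inner x y.
Proof. by rewrite mulr_sumr; apply: eq_bigr => l _; apply: innerZl. Qed.
Lemma dirsum_normE x : dirsum_norm x = Num.sqrt (dirsum_inner x x).
Proof. by congr Num.sqrt; apply: eq_bigr => l _; apply: sqr_norm_inner. Qed.
Lemma dirsum_inner_ge0 x : 0 <= dirsum_inner x x.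
Proof. by apply: sumr_ge0 => l _; apply: inner_ge0. Qed.
Lemma sqr_dirsum_norm x : dirsum_norm x ^+ 2 = dirsum_inner x x.
Proof. by rewrite dirsum_normE sqr_sqrtr ?dirsum_inner_ge0. Qed.

Lemma dirsum_norm_eq0 x : dirsum_norm x = 0 -> x = 0.
Proof.
move=> /eqP; rewrite sqrtr_eq0 => xle0; apply: functional_extensionality_dep => l.
apply/eqP; rewrite -normr_eq0 -sqrf_eq0 eq_le sqr_ge0 andbT.
by apply: le_trans xle0; rewrite (bigD1 l)//= lerDl sumr_ge0// => i _; rewrite sqr_ge0.
Qed.

Lemma dirsum_normZ a x : dirsum_norm (a *: x) = `|a| * dirsum_norm x.
Proof.
rewrite !dirsum_normE dirsum_innerZl dirsum_innerC dirsum_innerZl mulrA -expr2.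
by rewrite sqrtrM ?sqr_ge0// sqrtr_sqr.
Qed.

Lemma dirsum_cauchy x y : dirsum_inner x y <= dirsum_norm x * dirsum_norm y.
Proof.
set a := dirsum_norm x; set b := dirsum_norm y.
have b0 : 0 <= b by apply: sqrtr_ge0.
have a0 : 0 <= a by apply: sqrtr_ge0.
have [xz|xN0] := eqVneq a 0.
  by rewrite xz mul0r (dirsum_norm_eq0 xz) -(scale0r 0) dirsum_innerZl mul0r.
have [yz|yN0] := eqVneq b 0.
  by rewrite yz mulr0 (dirsum_norm_eq0 yz) dirsum_innerC -(scale0r 0)
    dirsum_innerZl mul0r.
have ab : 0 < a * b by rewrite mulr_gt0// lt_neqAle eq_sym ?xN0 ?yN0 ?a0 ?b0.
have := dirsum_inner_ge0 (b *: x + (- a) *: y).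
rewrite !(dirsum_innerDl, dirsum_innerZl) !(dirsum_innerC _ (_ + _)).
rewrite !(dirsum_innerDl, dirsum_innerZl) -!sqr_dirsum_norm -/a -/b.
rewrite (dirsum_innerC y x); set t := dirsum_inner x y => h.
rewrite -(ler_pM2l ab); move: h.
by nra.
Qed.

Lemma ler_dirsum_normD x y :
  dirsum_norm (x + y) <= dirsum_norm x + dirsum_norm y.
Proof.
rewrite -(@ler_pXn2r _ 2)// ?nnegrE ?addr_ge0 ?sqrtr_ge0//.
rewrite sqr_dirsum_norm dirsum_innerDl !(dirsum_innerC _ (_ + _)) !dirsum_innerDl.
rewrite sqrrD -!sqr_dirsum_norm (dirsum_innerC y x) mulr2n.
have := dirsum_cauchy x y.
set a := dirsum_inner x y; set b := _ * _; set c := _ ^+ 2; set d := _ ^+ 2.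
by move=> ab; rewrite -!addrA lerD2l !addrA lerD2r lerD.
Qed.

HB.instance Definition _ := @Lmodule_isNormed.Build R (dirsum H) dirsum_norm
  ler_dirsum_normD dirsum_normZ dirsum_norm_eq0.

Import VectorInternalTheory.

Fact dirsum_vect_iso : Vector.axiom (\sum_l dim (H l)) (dirsum H).
Proof.
pose F x : 'rV[R]_(\sum_l dim (H l)) := \mxrow_l v2r (x l).
pose G (m : 'rV[R]_(\sum_l dim (H l))) : dirsum H :=
  fun l => r2v (submxrow m l).
exists F.
  move=> a x y; apply/mxrowP => l.
  have subD (m n : 'rV[R]_(\sum_l dim (H l))) :
      submxrow (a *: m + n) l = a *: submxrow m l + submxrow n l.
    by apply/matrixP => i j; rewrite !mxE.
  by rewrite subD !mxrowK -linearZ -linearD.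
exists G => [x|m].
  apply: functional_extensionality_dep => l.
  by rewrite /G /F mxrowK v2rK.
by apply/mxrowP => l; rewrite /F mxrowK r2vK.
Qed.

HB.instance Definition _ := Lmodule_hasFinDim.Build R (dirsum H) dirsum_vect_iso.

HB.instance Definition _ := NormedVect_isHilbert.Build R (dirsum H)
  dirsum_innerC dirsum_innerDl dirsum_innerZl sqr_dirsum_norm.

End DirectSum.

Section Subdifferential.
Context {R : realType} {V : finHilbertType R}.
Implicit Types (h : V -> \bar R) (x u v : V).

(* By [riesz] the set below is a singleton whenever f is differentiable at x. *)
Definition grad (f : V -> R) x : V :=
  xget 0 [set u | forall w, 'd f x w = inner u w].

Definition C1 (f : V -> R) : Prop :=
  (forall x, differentiable f x) /\ continuous (grad f).

Definition edom h : set V := [set x | (h x < +oo)%E].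

Definition proper_fun h : Prop :=
  edom h !=set0 /\ forall x, (-oo < h x)%E.

(* The inequality never involves +oo - oo as it is used for h > -oo.          *)
Definition econvex h : Prop := forall (t : R) x y, 0 <= t <= 1 ->
  (h (t *: x + (1 - t) *: y)%R <= t%:E * h x + (1 - t)%:E * h y)%E.

(* Frechet subgradients: h y >= h x + <v, y - x> + o(|y - x|).                *)
Definition frechet_subdiff h x : set V := [set v |
  h x \is a fin_num /\
  forall e : R, 0 < e -> \forall y \near x,
    (h x + (inner v (y - x) - e * `|y - x|)%:E <= h y)%E].

(* Limiting (Mordukhovich) subdifferential.                                   *)
Definition subdiff h x : set V := [set v |
  h x \is a fin_num /\
  exists (y w : nat -> V),
    [/\ y @ \oo --> x, h (y n) @[n --> \oo] --> h x,
        w @ \oo --> v & forall n, frechet_subdiff h (y n) (w n)]].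

(* dist(0, A) in the extended reals; +oo when A is empty.                     *)
Definition dist0 (A : set V) : \bar R := ereal_inf [set `|v|%:E | v in A].

Definition desingularizing (eta : \bar R) (theta : R -> R) : Prop :=
  let D := [set t : R | 0 <= t /\ (t%:E < eta)%E] in
  [/\ forall t, D t -> 0 <= theta t,
      theta 0 = 0,
      forall (t : R) a b, 0 <= t <= 1 -> D a -> D b ->
        t * theta a + (1 - t) * theta b <= theta (t * a + (1 - t) * b),
      {within D, continuous theta} &
      forall t : R, 0 < t -> (t%:E < eta)%E ->
        [/\ derivable theta t 1, {for t, continuous (derive1 theta)} & 0 < derive1 theta t]].

Definition KL_at h x : Prop :=
  exists (eta : \bar R) (U : set V) (theta : R -> R),
    [/\ (0 < eta)%E, nbhs x U, desingularizing eta theta &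
      forall u, U u -> (h x < h u)%E -> (h u < h x + eta)%E ->
        (1 <= (derive1 theta (fine (h u - h x)%E))%:E * dist0 (subdiff h u))%E].

Definition sym_pos_def (A : 'End(V)) : Prop :=
  (forall u v, inner u (A v) = inner (A u) v) /\
  (forall u, u != 0 -> 0 < inner u (A u)).

Definition sqnorm (A : 'End(V)) u : R := inner u (A u).

Definition psi_regular (psi : V -> \bar R) : Prop :=
  [/\ forall x, (0 <= psi x)%E, econvex psi, proper_fun psi,
      lower_semicontinuous psi & [lipschitz fine (psi x) | x in edom psi]].

End Subdifferential.

Section ConcaveFunctions.
Context {R : realType}.
Implicit Types phi : \bar R -> \bar R.

(* Derivative relative to [0, +oo[ of a function on [0, +oo]: at 0 it is the  *)
(* right derivative. Only the values of phi on [0, +oo] matter.               *)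
Definition diffquot phi (t s : R) : R :=
  (fine (phi s%:E) - fine (phi t%:E)) / (s - t).

Definition dphi phi (t : R) : R :=
  lim (diffquot phi t s @[s --> within [set s | 0 <= s] t^']).

Definition phi_regular phi : Prop :=
  [/\ forall a, (0 <= a)%E -> (-oo < phi a)%E,
      forall (t : R) a b, 0 <= t <= 1 -> (0 <= a)%E -> (0 <= b)%E ->
        (t%:E * phi a + (1 - t)%:E * phi b <=
         phi (t%:E * a + (1 - t)%:E * b))%E,
      forall a b, (0 <= a)%E -> (a < b)%E -> (phi a < phi b)%E,
      forall t : R, 0 <= t -> phi t%:E \is a fin_num /\
        cvg (diffquot phi t s @[s --> within [set s | 0 <= s] t^']) &
      forall t : R, 0 <= t -> exists2 e, 0 < e &
        [lipschitz dphi phi s | s in [set s | 0 <= s] `&` ball t e]].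

End ConcaveFunctions.

Section Algorithm.
Context {R : realType} {L : nat} {H : 'I_L -> finHilbertType R}.

(* x + block j v is x + (0, ..., v, ..., 0) with v in position j.             *)
Definition block (j : 'I_L) (v : H j) : dirsum H :=
  @dfwith 'I_L H (fun=> 0) j v.

Definition block_lipschitz (f : dirsum H -> R) : Prop :=
  forall l j, exists2 beta : R, 0 < beta &
    forall (x : dirsum H) (v : H j),
      `|grad f (x + block v) l - grad f x l| <= beta * `|v|.

(* Blocks in J are taken from x, the others from y.                           *)
Definition mix (J : {set 'I_L}) (x y : dirsum H) : dirsum H :=
  fun l => if l \in J then x l else y l.

Definition majorant_ops := dirsum H -> {set 'I_L} -> forall l, 'End(H l).

(* The values of A y J l for l \notin J are irrelevant.                       *)
Definition quad_majorization (f : dirsum H -> R) (A : majorant_ops) : Prop :=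
  exists nu_lo nu_hi : R, [/\ 0 < nu_lo, 0 < nu_hi &
    forall y (J : {set 'I_L}),
      (forall l, l \in J ->
        sym_pos_def (A y J l) /\
        forall u, nu_lo * `|u| ^+ 2 <= sqnorm (A y J l) u <= nu_hi * `|u| ^+ 2) /\
      (forall x, f (mix J x y) <= f y +
        \sum_(l in J) (inner (x l - y l) (grad f y l) +
                       2^-1 * sqnorm (A y J l) (x l - y l)))].

Definition regularizer (phi : 'I_L -> \bar R -> \bar R)
    (psi : forall l, H l -> \bar R) (x : dirsum H) : \bar R :=
  (\sum_l phi l (psi l (x l)))%E.

Definition objective (f : dirsum H -> R) (phi : 'I_L -> \bar R -> \bar R)
    (psi : forall l, H l -> \bar R) (x : dirsum H) : \bar R :=
  ((f x)%:E + regularizer phi psi x)%E.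

(* Inexact forward-backward update of block l from x to x', with weight lam   *)
(* and metric A.                                                              *)
Definition block_update (f : dirsum H -> R) (l : 'I_L) (psi : H l -> \bar R)
    (delta mu lam : R) (A : 'End(H l)) (x x' : dirsum H) : Prop :=
  exists (alpha : R) (v : H l),
    [/\ 2^-1 + delta <= alpha, subdiff psi (x' l) v,
        (lam%:E * psi (x' l) +
         (inner (grad f x l) (x' l - x l) + alpha * sqnorm A (x' l - x l))%:E
           <= lam%:E * psi (x l))%E &
        `|grad f x l + lam *: v| <= mu * Num.sqrt (sqnorm A (x' l - x l))].

(* x k are the outer iterates, xt k i (i <= I k) the inner ones.              *)
Definition CO_BC_FB (f : dirsum H -> R) (phi : 'I_L -> \bar R -> \bar R)
    (psi : forall l, H l -> \bar R) (A : majorant_ops) (delta mu : R)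
    (I : nat -> nat) (J : nat -> nat -> {set 'I_L})
    (x : nat -> dirsum H) (xt : nat -> nat -> dirsum H) : Prop :=
  [/\ (regularizer phi psi (x 0%N) < +oo)%E,
      forall l, (psi l (x 0%N l) < +oo)%E,
      forall k, xt k 0%N = x k /\ x k.+1 = xt k (I k) &
      forall k i, (i < I k)%N -> forall l,
        if l \in J k i then
          block_update f (psi l) delta mu (dphi (phi l) (fine (psi l (x k l))))
            (A (xt k i) (J k i) l) (xt k i) (xt k i.+1)
        else xt k i.+1 l = xt k i l].

End Algorithm.

(* Main.v *)
Require Import Defs.
From HB Require Import structures.
From mathcomp Require Import all_boot all_order all_algebra.
From mathcomp Require Import all_classical all_reals all_analysis.
From mathcomp Require Import ring lra zify.

Set Implicit Arguments.
Unset Strict Implicit.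
Unset Printing Implicit Defensive.

Import Order.TTheory GRing.Theory Num.Theory.
Import numFieldNormedType.Exports.

Local Open Scope classical_set_scope.
Local Open Scope ring_scope.

(** Freezing the slopes [lam_l = phi_l'(psi_l(x^k_l))] during outer iteration k,
    the majorization of f makes [f + sum_l lam_l psi_l] decrease by at least
    [c |step|^2] at every inner step, and since phi_l lies below its tangents
    [Psi] inherits this decrease: [c S_k^2 <= Psi(x^k) - Psi(x^(k+1))], where S_k
    is the length of the inner path. The inexact optimality condition at the last
    update of each block gives a subgradient of [Psi] at x^(k+1) of norm at most
    [C S_k] as long as x^k stays near a cluster point xhat; there phi_l' is
    Lipschitz and bounded away from 0 along the iterates, so the multipliers v_l
    are bounded. The iterates recur to xhat by finite dimension, and the KL
    inequality at xhat traps them in a neighbourhood and makes [sum_k S_k] finite. *)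

(** * Tangents of concave functions *)

Section ConcaveTangent.
Context {R : realType}.
Implicit Types (h : R -> R) (s t d : R).

(** An epsilon form of the derivative relative to [0, +oo[, right-sided at t = 0. Both [dphi] and
    [derive1] satisfy it, so one tangent lemma serves phi and the desingularizing function. *)
Definition halfline_deriv h t d : Prop := forall e : R, 0 < e ->
  exists2 r, 0 < r & forall u, 0 <= u -> `|u - t| < r ->
    `|h u - h t - d * (u - t)| <= e * `|u - t|.

(** On the segment from t to s, concavity gives a (h s - h t) <= h (t + a (s - t)) - h t, and the
    expansion at t bounds the right side by a d (s - t) + a e for small a; divide by a. *)
Lemma concave_le_tangent h s t d : 0 <= s -> 0 <= t ->
  (forall a, 0 <= a <= 1 -> a * h s + (1 - a) * h t <= h (a * s + (1 - a) * t)) ->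
  halfline_deriv h t d -> h s <= h t + d * (s - t).
Proof.
move=> s0 t0 hconc hder.
have [->|st] := eqVneq s t; first by rewrite subrr mulr0 addr0.
apply/ler_addgt0Pr => e e0.
have st0 : 0 < `|s - t| by rewrite normr_gt0 subr_eq0.
have [r r0 hr] := hder (e / `|s - t|) (divr_gt0 e0 st0).
(* The bound 1 keeps the point on the segment; the other puts it within r / 2 of t. *)
pose a := Num.min 1 (r / (2 * `|s - t|)).
have a0 : 0 < a by rewrite lt_min ltr01 divr_gt0// mulr_gt0.
have a1 : a <= 1 by rewrite ge_min lexx.
have ar : a * `|s - t| < r.
  have : a <= r / (2 * `|s - t|) by rewrite ge_min lexx orbT.
  rewrite ler_pdivlMr ?mulr_gt0// => ?; nra.
have := hconc a; rewrite (ltW a0) a1 => /(_ isT) ca.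
have ut : a * s + (1 - a) * t - t = a * (s - t) by ring.
have := hr (a * s + (1 - a) * t).
rewrite ut normrM (gtr0_norm a0) => /(_ _ ar) H.
have /H : 0 <= a * s + (1 - a) * t.
  by rewrite addr_ge0 ?mulr_ge0 ?subr_ge0// ltW.
rewrite [X in _ <= X](_ : _ = e * a); last by field; rewrite gt_eqF.
move=> /(le_trans (ler_norm _)) H2.
rewrite -(ler_pM2l a0).
have : a * (d * (s - t)) = d * (a * (s - t)) by ring.
by nra.
Qed.

Lemma derive1_halfline_deriv h t : derivable h t 1 ->
  halfline_deriv h t (derive1 h t).
Proof.
move=> ht e e0.
have := ht; rewrite /derivable => /cvgrPdist_le /(_ e e0).
rewrite /= => /nbhs_normP[r /= r0 hr].
exists r => // u _ utr.
have [->|ut] := eqVneq u t; first by rewrite !subrr normr0 mulr0 subr0 normr0 mulr0.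
have ut0 : u - t != 0 by rewrite subr_eq0.
have /(_ _ ut0) := hr (u - t); rewrite /= sub0r normrN => /(_ utr).
rewrite scaler1 subrK -/(derive h t 1) -derive1E.
have -> : h u - h t - derive1 h t * (u - t) =
   - ((derive1 h t - (u - t)^-1 *: (h u - h t)) * (u - t)).
  by rewrite /GRing.scale/=; field.
by rewrite normrN normrM; apply: ler_wpM2r.
Qed.

End ConcaveTangent.

Section PhiRegular.
Context {R : realType}.
Variable phi : \bar R -> \bar R.
Hypothesis phi_reg : phi_regular phi.
Implicit Types s t : R.

Let phir t : R := fine (phi t%:E).

Lemma phi_regular_fin t : 0 <= t -> phi t%:E = (phir t)%:E.
Proof. by case: phi_reg => _ _ _ + _ t0 => /(_ t t0)[? _]; rewrite fineK. Qed.

Lemma dphi_halfline_deriv t : 0 <= t -> halfline_deriv phir t (dphi phi t).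
Proof.
case: phi_reg => _ _ _ + _ t0 => /(_ t t0)[_ hc] e e0.
have /cvgrPdist_le/(_ e e0) : diffquot phi t s @[s --> within [set s | 0 <= s] t^'] --> dphi phi t.
  exact: hc.
rewrite /= => /nbhs_normP[r /= r0 hr].
exists r => // u u0 utr.
have [->|ut] := eqVneq u t; first by rewrite !subrr normr0 mulr0 subr0 normr0 mulr0.
have ut0 : u - t != 0 by rewrite subr_eq0.
have := hr u; rewrite /= distrC => /(_ utr ut u0).
rewrite /diffquot -/(phir u) -/(phir t).
have -> : phir u - phir t - dphi phi t * (u - t) =
   - ((dphi phi t - (phir u - phir t) / (u - t)) * (u - t)).
  by rewrite mulrBl mulfVK// opprB.
by rewrite normrN normrM; apply: ler_wpM2r.
Qed.

Lemma phi_le_tangent s t : 0 <= s -> 0 <= t ->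
  phir s <= phir t + dphi phi t * (s - t).
Proof.
move=> s0 t0; apply: concave_le_tangent (dphi_halfline_deriv t0) => // a a01.
case: phi_reg => _ + _ _ _ => /(_ a s%:E t%:E a01).
rewrite !lee_fin => /(_ s0 t0).
move: (a01) => /andP[a0 a1].
rewrite -!EFinM -EFinD !phi_regular_fin// -?EFinM -?EFinD ?lee_fin//.
by rewrite addr_ge0 ?mulr_ge0 ?subr_ge0.
Qed.

(** Strict increase gives phi t < phi (t + 1), and the tangent at t bounds this increment by
    [dphi phi t]. *)
Lemma dphi_gt0 t : 0 <= t -> 0 < dphi phi t.
Proof.
move=> t0; have t10 : 0 <= t + 1 by rewrite addr_ge0.
case: phi_reg => _ _ + _ _ => /(_ t%:E (t + 1)%:E).
rewrite lee_fin lte_fin => /(_ t0); rewrite ltrDl ltr01 => /(_ isT).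
rewrite !phi_regular_fin// lte_fin => lt1.
have := phi_le_tangent t10 t0; rewrite addrAC subrr add0r mulr1 => h.
by rewrite -(ltrD2l (phir t)) addr0 (lt_le_trans lt1).
Qed.

End PhiRegular.

(** * Finite length from the Kurdyka-Lojasiewicz inequality *)

Section KLFiniteLength.
Context {R : realType} {V : normedModType R}.
(** In the application r k is Psi(x^k) - Psi(xhat), S k is the inner path length, and [slope]
    combines the KL inequality at xhat with the subgradient bound. The point xhat is assumed to be
    revisited, not to be the limit. *)
Variables (eta : \bar R) (theta : R -> R) (x : nat -> V) (xhat : V).
Variables (S r : nat -> R) (c C rho : R).
Hypotheses (theta_des : desingularizing eta theta) (eta_gt0 : (0 < eta)%E).
Hypotheses (c_gt0 : 0 < c) (C_ge0 : 0 <= C) (rho_gt0 : 0 < rho).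
Hypothesis step : forall k, `|x k.+1 - x k| <= S k.
Hypothesis descent : forall k, c * S k ^+ 2 <= r k - r k.+1.
Hypothesis recur : forall (e : R) N, 0 < e ->
  exists2 k, (N <= k)%N & `|x k - xhat| < e /\ `|r k| < e.
Hypothesis slope : forall k, `|x k - xhat| < rho -> `|x k.+1 - xhat| < rho ->
  S k <= 1 -> 0 < r k.+1 -> ((r k.+1)%:E < eta)%E ->
  1 <= derive1 theta (r k.+1) * (C * S k).

Let S_ge0 k : 0 <= S k. Proof. exact: le_trans (step k). Qed.

Let r_anti m n : (m <= n)%N -> r n <= r m.
Proof.
move=> /subnK <-; elim: (n - m)%N => // k IH; rewrite addSn.
apply: le_trans IH; rewrite -subr_ge0; apply: le_trans (descent _).
by rewrite mulr_ge0 ?sqr_ge0// ltW.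
Qed.

(** The values decrease, so a negative one would keep all later ones away from 0, against
    [recur]. *)
Let r_ge0 k : 0 <= r k.
Proof.
rewrite leNgt; apply/negP => rk.
have rk' : 0 < - r k by rewrite oppr_gt0.
have [n kn [_]] := recur k rk'.
have h := r_anti kn; rewrite ltr0_norm; first by lra.
exact: le_lt_trans rk.
Qed.

Lemma kl_values_small (e : R) : 0 < e -> exists N, forall k, (N <= k)%N -> r k < e.
Proof.
move=> e0; have [n _ [_ rn]] := recur 0%N e0; exists n => k nk.
exact: le_lt_trans (r_anti nk) (le_lt_trans (ler_norm _) rn).
Qed.

Lemma kl_steps_small (e : R) : 0 < e -> exists N, forall k, (N <= k)%N -> S k < e.
Proof.
move=> e0; have ce : 0 < c * e ^+ 2 by rewrite mulr_gt0// exprn_gt0.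
have [N hN] := kl_values_small ce; exists N => k Nk.
rewrite ltNge; apply/negP => eS.
have : c * e ^+ 2 <= c * S k ^+ 2 by rewrite ler_pM2l// ler_pXn2r// ?nnegrE// ltW.
have := descent k; have := hN k Nk; have := r_ge0 k.+1; lra.
Qed.

Let eta_bound : exists2 d : R, 0 < d & forall t, t < d -> (t%:E < eta)%E.
Proof.
case: (eta) eta_gt0 => [a||] //; first by rewrite lte_fin => a0; exists a.
by move=> _; exists 1 => // t _; rewrite ltry.
Qed.

Lemma desingularizing_small (e : R) : 0 < e ->
  exists2 d : R, 0 < d & forall t, 0 <= t -> t < d -> theta t < e.
Proof.
move=> e0; have [d0 d00 hd0] := eta_bound.
case: theta_des => _ th0 _ /subspace_continuousP/(_ 0) + _.
move=> /(_ (conj (lexx 0) eta_gt0))/cvgrPdist_lt/(_ e e0)/= /nbhs_normP[d /= dp hd].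
(* Staying below d0 keeps t in [0, eta[, where the continuity of [theta] is known. *)
exists (Num.min d d0); first by rewrite lt_min dp.
move=> t t0; rewrite lt_min => /andP[td td0].
apply: le_lt_trans (ler_norm _) _.
have := hd t; rewrite /= sub0r normrN (ger0_norm t0) => /(_ td).
by move=> /(_ (conj t0 (hd0 _ td0))); rewrite /from_subspace th0 sub0r normrN.
Qed.

Lemma desingularizing_tangent s t : 0 <= s -> s <= t -> 0 < t -> (t%:E < eta)%E ->
  theta s <= theta t + derive1 theta t * (s - t).
Proof.
move=> s0 st t0 te; case: theta_des => _ _ conc _ /(_ t t0 te)[dt _ _].
apply: concave_le_tangent (derive1_halfline_deriv dt); rewrite ?(ltW t0)//.
move=> a a01; apply: conc => //; split => //; last by rewrite ltW.
exact: le_lt_trans te.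
Qed.

(* AM-GM turns [c S_(k+1)^2 <= C S_k (theta r_(k+1) - theta r_(k+2))] into a    *)
(* recursion that telescopes.                                                 *)
Let step_recursion k : `|x k - xhat| < rho -> `|x k.+1 - xhat| < rho ->
  S k <= 1 -> ((r k.+1)%:E < eta)%E ->
  2 * S k.+1 <= S k + C / c * (theta (r k.+1) - theta (r k.+2)).
Proof.
move=> xk xk1 Sk1 re.
have := descent k.+1; have := r_ge0 k.+2; have rr := r_anti (leqnSn k.+1).
have := r_ge0 k.+1; rewrite le_eqVlt => /predU1P[r0|r0] r20 de.
  (* KL is silent when r_(k+1) = 0, but the values are then stationary and descent forces S_(k+1) =
     0. *)
  have r2 : r k.+2 = 0 by apply: le_anti; rewrite r20 r0 rr.
  have : S k.+1 ^+ 2 <= 0.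
    by rewrite -(ler_pM2l c_gt0) mulr0 (le_trans de)// -r0 r2 subrr.
  rewrite -r0 r2 subrr mulr0 addr0 => S2.
  have : S k.+1 ^+ 2 == 0 by rewrite eq_le S2 sqr_ge0.
  by rewrite sqrf_eq0 => /eqP ->; rewrite mulr0.
have s1 := slope xk xk1 Sk1 r0 re.
have tg := desingularizing_tangent r20 rr r0 re.
have th0 : 0 < derive1 theta (r k.+1).
  by case: theta_des => _ _ _ _ /(_ _ r0 re)[].
set D := theta _ - theta _; set p := derive1 theta _ in s1 tg th0.
have pD : p * (c * S k.+1 ^+ 2) <= D.
  have : p * (c * S k.+1 ^+ 2) <= p * (r k.+1 - r k.+2) by rewrite ler_pM2l.
  by rewrite /D; nra.
have D0 : 0 <= D.
  by apply: le_trans pD; rewrite !mulr_ge0 ?sqr_ge0// ltW.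
(* Multiplying the KL bound 1 <= p C S_k by c S_(k+1)^2 lets [pD] absorb p. *)
have cS : c * S k.+1 ^+ 2 <= (C * S k) * D.
  have CS : 0 <= C * S k by rewrite mulr_ge0.
  have S0 : 0 <= c * S k.+1 ^+ 2 by rewrite mulr_ge0 ?sqr_ge0// ltW.
  have := ler_wpM2l CS pD; apply: le_trans.
  by have := ler_wpM2r S0 s1; rewrite mul1r => /le_trans; apply; nra.
set M := C / c; have M0 : 0 <= M by rewrite divr_ge0// ltW.
have SM : S k.+1 ^+ 2 <= S k * (M * D).
  rewrite -(ler_pM2l c_gt0) (le_trans cS)// le_eqVlt; apply/orP; left.
  by apply/eqP; rewrite /M; field; rewrite gt_eqF.
have MD := mulr_ge0 M0 D0.
rewrite -(@ler_pXn2r _ 2)// ?nnegrE ?addr_ge0// ?mulr_ge0//.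
by have := sqr_ge0 (S k - M * D); nra.
Qed.

(** Start the recursion at a visit to xhat so late that the steps, the values and their images under
    [theta] are tiny. The summed recursions bound the path travelled by S_m + M theta(r_(m+1)) <=
    rho / 4, so the iterates never leave the ball where the recursion holds. *)
Lemma kl_finite_length : exists B, forall n, \sum_(k < n) S k <= B.
Proof.
set M := C / c; have M0 : 0 <= M by rewrite divr_ge0// ltW.
have rho8 : 0 < rho / 8 by rewrite divr_gt0.
have [d dp hd] := eta_bound.
(* M may be 0, hence the division by M + 1; M theta(r k) is then at most rho / 8. *)
have e1 : 0 < rho / 8 / (M + 1) by rewrite divr_gt0// ltr_wpDl.
have [d1 d1p hd1] := desingularizing_small e1.
have [N1 hN1] := kl_values_small dp.
have [N2 hN2] := kl_values_small d1p.
have m1 : 0 < Num.min 1 (rho / 8) by rewrite lt_min ltr01.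
have [N3 hN3] := kl_steps_small m1.
pose N := (N1 + N2 + N3)%N.
(* An index above N is a successor m + 1 with N <= m, so x_m is one small step away from the
   visit. *)
have [m' Nm [xm _]] := recur N.+1 rho8.
case: m' Nm xm => // m Nm xm.
have [N1m N2m N3m] : [/\ N1 <= m, N2 <= m & N3 <= m]%N.
  by clear -Nm; subst N; split; lia.
have hS k : (m <= k)%N -> S k < 1 /\ S k < rho / 8.
  move=> mk; have /hN3 := leq_trans N3m mk.
  by rewrite lt_min => /andP.
have hr k : (m <= k)%N -> ((r k)%:E < eta)%E.
  by move=> mk; apply: hd; apply: hN1; exact: leq_trans mk.
have hth k : (m <= k)%N -> M * theta (r k) <= rho / 8.
  move=> mk; have tk : theta (r k) < rho / 8 / (M + 1).
    by apply: hd1 => //; apply: hN2; exact: leq_trans mk.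
  have : M * theta (r k) <= M * (rho / 8 / (M + 1)) by rewrite ler_wpM2l// ltW.
  move=> /le_trans; apply; rewrite mulrA ler_pdivrMr ?ltr_wpDl//; nra.
have th_ge0 k : (m <= k)%N -> 0 <= M * theta (r k).
  by move=> mk; rewrite mulr_ge0//; case: theta_des => + _ _ _ _; apply; split => //; apply: hr.
have mS n : (m <= m.+1 + n)%N by rewrite addSn leqW// leq_addr.
(* The extra term S (m + n) pays for the S_k on the right of the next recursion, and the [theta]
   differences telescope. *)
have main n : \sum_(i < n) S (m.+1 + i)%N + S (m + n)%N <=
      S m + M * (theta (r m.+1) - theta (r (m.+1 + n)%N)) /\
    `|x (m.+1 + n)%N - xhat| < rho /\ `|x (m + n)%N - xhat| < rho.
  elim: n => [|n [IH [x1 x2]]].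
    rewrite big_ord0 !addn0 subrr mulr0 add0r addr0; split=> //; split; first by lra.
    have := step m; have [_] := hS m (leqnn m).
    rewrite distrC; have := ler_distD (x m.+1) (x m) xhat; lra.
  have mn : (m <= m + n)%N by rewrite leq_addr.
  have := @step_recursion (m + n) x2; rewrite -addSn.
  move=> /(_ x1 (ltW (hS _ mn).1) (hr _ (mS n))) rec.
  have Q : \sum_(i < n.+1) S (m.+1 + i)%N + S (m + n.+1)%N <=
      S m + M * (theta (r m.+1) - theta (r (m.+1 + n.+1)%N)).
    rewrite big_ord_recr/= addnS !addSn !addnS; move: IH rec; rewrite -/M !addSn.
    rewrite !mulrBr; lra.
  split=> //; split; last by rewrite addnS -addSn.
  have xx : `|x (m.+1 + n.+1)%N - x m.+1| <= \sum_(i < n.+1) S (m.+1 + i)%N.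
    elim: n.+1 => [|j IHj]; first by rewrite addn0 subrr normr0 big_ord0.
    rewrite big_ord_recr/= addnS (le_trans (ler_distD (x (m.+1 + j)%N) _ _))//.
    by rewrite addrC lerD.
  apply: le_lt_trans (ler_distD (x m.+1) _ _) _.
  have := hth m.+1 (leqnSn m); have [_] := hS m (leqnn m).
  have := th_ge0 _ (mS n.+1); have := S_ge0 (m + n.+1)%N.
  move: Q xx xm; rewrite !mulrBr; lra.
exists (\sum_(k < m.+1) S k + (S m + M * theta (r m.+1))) => n.
have /le_trans : \sum_(k < n) S k <= \sum_(k < m.+1 + n) S k.
  by rewrite addnC big_split_ord/= lerDl sumr_ge0.
apply; rewrite big_split_ord/= lerD2l.
have [+ _] := main n; have := th_ge0 _ (mS n).
rewrite mulrBr; have := S_ge0 (m + n)%N; lra.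
Qed.

End KLFiniteLength.

(** * Finite-dimensional Hilbert spaces and subgradients *)

Section Hilbert.
Context {R : realType} {V : finHilbertType R}.
Implicit Types (u v w x y : V).

Lemma inner_le_norm u v : inner u v <= `|u| * `|v|.
Proof.
(* V is seen as a direct sum with a single summand, where Cauchy-Schwarz is known. *)
have := @dirsum_cauchy R 1 (fun=> V) (fun=> u) (fun=> v).
by rewrite /dirsum_inner /dirsum_norm !big_ord1 !sqrtr_sqr !normr_id.
Qed.

Lemma innerBr u v w : inner u (v - w) = inner u v - inner u w.
Proof. by rewrite innerC innerBl !(innerC u). Qed.

Lemma innerNl u v : inner (- u) v = - inner u v.
Proof. by rewrite -scaleN1r innerZl mulN1r. Qed.

Lemma norm_inner u v : `|inner u v| <= `|u| * `|v|.
Proof.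
by rewrite ler_norml inner_le_norm andbT lerNl -innerNl -(normrN u) inner_le_norm.
Qed.

Import VectorInternalTheory.

(** Coordinates are linear forms, bounded along the sequence by Riesz and Cauchy-Schwarz; the
    coordinate vectors stay in a compact box and have a cluster point there. *)
Lemma bounded_seq_recurrent (x : nat -> V) (M : R) : (forall k, `|x k| <= M) ->
  exists xhat, forall (e : R) N, 0 < e -> exists2 k, (N <= k)%N & `|x k - xhat| < e.
Proof.
move=> xM; set n := dim V.
have coordP (i : 'I_n) : exists u, forall v, v2r v 0 i = inner u v.
  have lin : linear (fun v => v2r v 0 i : R^o).
    by move=> a u v; rewrite linearP !mxE.
  pose F : {linear V -> R^o} := HB.pack (fun v => v2r v 0 i : R^o)
    (GRing.isLinear.Build R V R^o _ (fun v => v2r v 0 i : R^o) lin).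
  by have [u Fu] := riesz F; exists u => v; rewrite -Fu.
have [u uP] := choice coordP.
pose g : 'rV[R]_(dim V) -> V := @r2v R V.
pose m k : 'rV[R]_n := v2r (x k).
have mB k i : m k 0 i \in `[- (`|u i| * M), `|u i| * M]%R.
  rewrite in_itv/= -ler_norml /m uP (le_trans (norm_inner _ _))//.
  exact: ler_wpM2l.
have := @rV_compact R n (fun i => [set` `[- (`|u i| * M), `|u i| * M]%R])
  (fun i => @segment_compact R _ _).
move=> /(_ (m @ \oo)) [|mhat [_ mhatP]].
  by exists 0%N => // k _ i; exact: mB.
exists (g mhat) => e N e0.
pose b i : V := g (delta_mx 0 i).
(* Coordinate errors below e / s add up to a norm error below e; the + 1 keeps s positive. *)
pose s := \sum_i `|b i| + 1.
have s0 : 0 < s by rewrite ltr_wpDl// sumr_ge0.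
have es : 0 < e / s by rewrite divr_gt0.
have [|p [[k Nk <-] kb]] := mhatP [set m k | k in [set k | (N <= k)%N]] (ball mhat (e / s)) _ (nbhsx_ballx _ _ es).
  by exists N => // k /= Nk; exists k.
exists k => //.
have -> : x k - g mhat = \sum_i (m k 0 i - mhat 0 i) *: b i.
  rewrite -{1}(v2rK (x k)) -linearB (row_sum_delta (_ - _)) /g linear_sum.
  by apply: eq_bigr => i _; rewrite linearZ/= !mxE.
apply: le_lt_trans (ler_norm_sum _ _ _) _.
apply: (@le_lt_trans _ _ (e / s * \sum_i `|b i|)); last first.
  by rewrite mulrAC ltr_pdivrMr// ltr_pM2l// /s ltrDl.
rewrite mulr_sumr ler_sum// => i _; rewrite normrZ ler_wpM2r// distrC ltW//.
exact: (kb.2 0 i).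
Qed.

End Hilbert.

Lemma lipschitz_constant {R : realType} {V W : normedModType R} (g : V -> W)
    (D : set V) : [lipschitz g x | x in D] ->
  exists2 k : R, 0 < k & forall x y, D x -> D y -> `|g x - g y| <= k * `|x - y|.
Proof.
move=> /pinfty_ex_gt0[k k0 hk]; exists k => // x y Dx Dy.
exact: (hk (x, y) (conj Dx Dy)).
Qed.

Section Subgradients.
Context {R : realType} {V : finHilbertType R}.
Implicit Types (h psi : V -> \bar R) (u v w x y z : V).

Lemma nbhs_distP x (P : set V) :
  nbhs x P <-> exists2 r : R, 0 < r & forall y, `|y - x| < r -> P y.
Proof.
split=> [/nbhs_normP[r r0 rP]|[r r0 rP]].
  by exists r => // y; rewrite distrC; exact: rP.
by apply/nbhs_normP; exists r => // y /=; rewrite distrC; exact: rP.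
Qed.

Lemma psi_regular_fin psi x : psi_regular psi -> edom psi x -> psi x \is a fin_num.
Proof. by case=> p0 _ _ _ _ px; rewrite ge0_fin_numE. Qed.

(** The Frechet inequality is local; tested at a z + (1 - a) y for small a, where convexity bounds
    psi, and divided by a, it becomes global. *)
Lemma convex_frechet_subdiff psi y w z : (forall x, (-oo < psi x)%E) ->
  econvex psi -> frechet_subdiff psi y w ->
  (psi y + (inner w (z - y))%:E <= psi z)%E.
Proof.
move=> pNy conv [fy hy].
case pz : (psi z) => [c||]; [|by rewrite leey|by have := pNy z; rewrite pz].
rewrite -(fineK fy) -EFinD lee_fin; set b := fine (psi y).
have [zy|zy] := eqVneq z y.
  by move: pz; rewrite zy subrr -(subrr y) innerBr subrr addr0 /b => ->.
apply/ler_addgt0Pr => e e0.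
have zy0 : 0 < `|z - y| by rewrite normr_gt0 subr_eq0.
have := hy (e / `|z - y|) (divr_gt0 e0 zy0) => /nbhs_distP[r r0 hr].
pose a := Num.min 1 (r / (2 * `|z - y|)).
have a0 : 0 < a by rewrite lt_min ltr01 divr_gt0// mulr_gt0.
have a1 : a <= 1 by rewrite ge_min lexx.
have ar : a * `|z - y| < r.
  have : a <= r / (2 * `|z - y|) by rewrite ge_min lexx orbT.
  by rewrite ler_pdivlMr ?mulr_gt0// => ?; nra.
have ayz : a *: z + (1 - a) *: y - y = a *: (z - y).
  by rewrite scalerBl scale1r scalerBr addrA addrAC addrK.
have := hr (a *: z + (1 - a) *: y); rewrite ayz normrZ (gtr0_norm a0) => /(_ ar).
have := conv a z y; rewrite (ltW a0) a1 => /(_ isT) cv /le_trans/(_ cv).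
rewrite pz -(fineK fy) -/b -!EFinM -!EFinD lee_fin innerZr.
rewrite [e / _ * _](_ : _ = e * a); last by field; rewrite gt_eqF.
by move=> ?; rewrite -(ler_pM2l a0); nra.
Qed.

(** Each approximating Frechet subgradient satisfies the global inequality, which survives the
    passage to the limit. *)
Lemma convex_subdiff psi x v z : psi_regular psi -> subdiff psi x v ->
  (psi x + (inner v (z - x))%:E <= psi z)%E.
Proof.
move=> preg [fx [y [w [yx psiyx wv yw]]]].
have [p0 conv [_ pNy] _ _] := preg.
case pz : (psi z) => [c||]; [|by rewrite leey|by have := pNy z; rewrite pz].
rewrite -(fineK fx) -EFinD lee_fin.
have bnd n : fine (psi (y n)) + inner (w n) (z - y n) <= c.
  have [fy _] := yw n.
  have := convex_frechet_subdiff z pNy conv (yw n).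
  by rewrite pz -(fineK fy) -EFinD lee_fin.
have yx0 : `|x - y n| @[n --> \oo] --> (0 : R).
  by rewrite -(normr0 V) -(subrr x); apply: cvg_norm; apply: cvgB yx; exact: cvg_cst.
have wv0 : `|v - w n| @[n --> \oo] --> (0 : R).
  by rewrite -(normr0 V) -(subrr v); apply: cvg_norm; apply: cvgB wv; exact: cvg_cst.
have pc : fine (psi (y n)) @[n --> \oo] --> fine (psi x).
  by apply: fine_cvg; rewrite fineK.
(* Replacing <w_n, z - y_n> by <v, z - x> costs terms in |v - w_n| and |x - y_n|, which vanish. *)
have ub n : fine (psi (y n)) <= c - inner v (z - x) +
   (`|v - w n| * (`|z - x| + `|x - y n|) + `|v| * `|x - y n|).
  have := bnd n.
  have -> : inner (w n) (z - y n) = inner v (z - x) + inner v (x - y n)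
     - inner (v - w n) (z - y n).
    by rewrite innerBl !innerBr; ring.
  have := norm_inner v (x - y n); have := norm_inner (v - w n) (z - y n).
  rewrite !ler_norml => /andP[_ h1] /andP[h2 _].
  have : `|v - w n| * `|z - y n| <= `|v - w n| * (`|z - x| + `|x - y n|).
    by apply: ler_wpM2l => //; exact: ler_distD.
  lra.
rewrite -lerBrDr.
apply: (ler_cvg_to pc _ (nearW _ ub)).
rewrite -[X in _ --> X]addr0; apply: cvgD; first exact: cvg_cst.
rewrite -[X in _ --> X]addr0; apply: cvgD.
  rewrite -(mul0r (`|z - x| + 0)); apply: cvgM => //.
  by apply: cvgD => //; exact: cvg_cst.
by rewrite -(mulr0 `|v|); apply: cvgM => //; exact: cvg_cst.
Qed.

(** If psi x were +oo, lower semicontinuity would make psi arbitrarily large near x, whereas the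
    Lipschitz bound caps it at nearby points of the domain. *)
Lemma edom_closed psi x : psi_regular psi ->
  (forall r : R, 0 < r -> exists2 z, edom psi z & `|z - x| < r) -> edom psi x.
Proof.
move=> preg hx; have [p0 _ _ lsc /lipschitz_constant[k k0 lip]] := preg.
rewrite /edom/= ltNge leye_eq; apply/negP => /eqP px.
have [z0 z0d z0x] := hx _ ltr01.
(* Both z0 and the point z chosen below lie within 1 of x, so psi z <= psi z0 + 2 k. *)
have [|U /nbhs_distP[r r0 rU] hU] := lsc x (fine (psi z0) + 2 * k).
  by rewrite px ltry.
have [|z zd] := hx (Num.min r 1); first by rewrite lt_min r0 ltr01.
rewrite lt_min => /andP[zr z1].
have := hU _ (rU _ zr); rewrite -(fineK (psi_regular_fin preg zd)) lte_fin.
have := lip z z0 zd z0d; rewrite ler_norml => /andP[_].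
have := ler_distD x z z0; rewrite (distrC x z0) => h h1 h2.
have : k * `|z - z0| <= k * 2 by rewrite ler_wpM2l// ?(ltW k0)//; lra.
lra.
Qed.
End Subgradients.

Section Gradient.
Context {R : realType} {V : finHilbertType R}.
Implicit Types (f : V -> R) (g : V -> \bar R) (x v : V).

Lemma gradP f x w : 'd f x w = inner (grad f x) w.
Proof.
rewrite /grad; have [u du] := riesz ('d f x).
exact: (@xgetPex _ 0 [set u | forall w, 'd f x w = inner u w] (ex_intro _ u du)).
Qed.

Lemma differentiable_grad f x : differentiable f x -> forall e : R, 0 < e ->
  \forall y \near x, `|f y - f x - inner (grad f x) (y - x)| <= e * `|y - x|.
Proof.
move=> /diff_locallyP[_ /eqaddoP fx] e e0.
have /nbhs_distP[r r0 hr] := fx e e0.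
apply/nbhs_distP; exists r => // y yx.
have := hr (y - x); rewrite subr0 => /(_ yx).
by rewrite /= !fctE /shift/= subrK gradP opprD addrA.
Qed.

Lemma frechet_subdiffD_differentiable f g x v :
  differentiable f x -> frechet_subdiff g x v ->
  frechet_subdiff (fun y => (f y)%:E + g y)%E x (grad f x + v).
Proof.
move=> df [gx hg]; split; first by rewrite fin_numD gx.
move=> e e0; have e20 : 0 < e / 2 by rewrite divr_gt0.
apply: filterS2 (differentiable_grad df e20) (hg _ e20) => y fy gy.
apply: (@le_trans _ _ ((f y)%:E + (g x + (inner v (y - x) - e / 2 * `|y - x|)%:E))%E); last first.
  by rewrite leeD2l.
rewrite -(fineK gx) -!EFinD lee_fin innerDl.
by move: fy; rewrite ler_norml => /andP[+ _]; lra.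
Qed.

End Gradient.

(** * Chain rule for a concave function of a convex one *)

Section Composition.
Context {R : realType} {V : finHilbertType R}.
Variables (phi : \bar R -> \bar R) (psi : V -> \bar R).
Hypotheses (phi_reg : phi_regular phi) (psi_reg : psi_regular psi).

Lemma fine_psi_ge0 z : 0 <= fine (psi z).
Proof. by case: psi_reg => p0 _ _ _ _; rewrite fine_ge0. Qed.

Lemma phi_psi_fin z : edom psi z ->
  phi (psi z) = (fine (phi (fine (psi z))%:E))%:E.
Proof.
move=> zd; rewrite -{1}(fineK (psi_regular_fin psi_reg zd)).
by rewrite (phi_regular_fin phi_reg)// fine_psi_ge0.
Qed.

(* Outside dom psi the value phi(+oo), which may be finite, still exceeds       *)
(* phi(psi x) by a positive gap, so the inequality holds near x.               *)
Lemma frechet_subdiff_comp x v : subdiff psi x v ->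
  frechet_subdiff (fun z => phi (psi z)) x (dphi phi (fine (psi x)) *: v).
Proof.
move=> xv; have [fx _] := xv.
have xd : edom psi x by rewrite /edom/=; move: fx; rewrite fin_numElt => /andP[].
have [_ _ _ _ /lipschitz_constant[k k0 lip]] := psi_reg.
have t0 := fine_psi_ge0 x; set t := fine (psi x) in t0 *.
have d0 := dphi_gt0 phi_reg t0; set d := dphi phi t in d0 *.
rewrite /frechet_subdiff/= phi_psi_fin// -/t; split => // e e0.
have ek : 0 < e / k by rewrite divr_gt0.
(* As psi is k-Lipschitz on its domain, a remainder e / k * |u - t| is at most e * |z - x|. *)
have [r r0 hr] := dphi_halfline_deriv phi_reg t0 ek.
have t10 : 0 <= t + 1 by rewrite addr_ge0.
pose gap := fine (phi (t + 1)%:E) - fine (phi t%:E).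
have [_ _ incr _ _] := phi_reg.
have gap0 : 0 < gap.
  have := incr t%:E (t + 1)%:E; rewrite lee_fin lte_fin ltrDl ltr01 => /(_ t0 isT).
  by rewrite (phi_regular_fin phi_reg t0) (phi_regular_fin phi_reg t10) lte_fin subr_gt0.
apply/nbhs_distP; exists (Num.min (r / k) (gap / (`|d *: v| + 1))).
  by rewrite lt_min !divr_gt0// ltr_wpDl.
move=> z; rewrite lt_min => /andP[zr zg].
have [zd|] := boolP (psi z < +oo)%E; last first.
  rewrite -leNgt leye_eq => /eqP zoo.
  have lt1 : ((fine (phi (t + 1)%:E))%:E <= phi (psi z))%E.
    by rewrite -(phi_regular_fin phi_reg t10) ltW// incr// zoo ltry.
  apply: le_trans lt1; rewrite -EFinD lee_fin.
  have nv : 0 < `|d *: v| + 1 by rewrite ltr_wpDl.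
  move: zg; rewrite ltr_pdivlMr// /gap.
  have := inner_le_norm (d *: v) (z - x).
  have : 0 <= e * `|z - x| by rewrite mulr_ge0// ltW.
  have := normr_ge0 (z - x); lra.
have fz := psi_regular_fin psi_reg zd.
rewrite (phi_psi_fin zd) -EFinD lee_fin; set u := fine (psi z).
have lzx := lip _ _ zd xd; rewrite -/u -/t in lzx.
have ut : `|u - t| < r.
  by apply: le_lt_trans lzx _; rewrite mulrC -ltr_pdivlMr.
have := hr u (fine_psi_ge0 z) ut; rewrite ler_norml => /andP[h _].
have : e / k * `|u - t| <= e * `|z - x|.
  rewrite -mulrA ler_wpM2l ?(ltW e0)// ler_pdivrMl//.
have := convex_subdiff z psi_reg xv.
rewrite -(fineK fx) -(fineK fz) -EFinD lee_fin -/u -/t => sub.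
(* As d > 0, the convex subgradient inequality keeps its direction when multiplied by d. *)
have : d * inner v (z - x) <= d * (u - t) by rewrite ler_pM2l//; lra.
rewrite -/d in h; rewrite innerZl; lra.
Qed.

Lemma phi_psi_continuous x : edom psi x -> forall e : R, 0 < e ->
  \forall z \near x, edom psi z ->
   `|fine (phi (fine (psi z))%:E) - fine (phi (fine (psi x))%:E)| <= e.
Proof.
move=> xd e e0.
have [_ _ _ _ /lipschitz_constant[k k0 lip]] := psi_reg.
have t0 := fine_psi_ge0 x; set t := fine (psi x) in t0 *.
have [r r0 hr] := dphi_halfline_deriv phi_reg t0 ltr01.
set d := dphi phi t in hr; have d0 : 0 < d := dphi_gt0 phi_reg t0.
(* The expansion with tolerance 1 gives |phi u - phi t| <= (d + 1) |u - t| <= (d + 1) k |z - x|. *)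
apply/nbhs_distP; exists (Num.min (r / k) (e / (k * (d + 1)))).
  by rewrite lt_min !divr_gt0// mulr_gt0// addr_gt0.
move=> z; rewrite lt_min => /andP[zr ze] zd.
have lzx := lip _ _ zd xd; set u := fine (psi z) in lzx *; rewrite -/t in lzx.
have ut : `|u - t| < r by apply: le_lt_trans lzx _; rewrite mulrC -ltr_pdivlMr.
have h := hr u (fine_psi_ge0 z) ut.
rewrite -[X in `|X|](subrK (d * (u - t))).
apply: le_trans (ler_normD _ _) _; rewrite normrM (gtr0_norm d0).
move: ze; rewrite ltr_pdivlMr ?mulr_gt0 ?addr_gt0//.
have := ler_wpM2r (addr_ge0 (ltW d0) ler01) lzx; lra.
Qed.

End Composition.

(** * Direct sums and the objective *)

Section DirectSumSubgradients.
Context {R : realType} {L : nat} {H : 'I_L -> finHilbertType R}.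
Implicit Types (x y z v : dirsum H).

Lemma norm_coord x l : `|x l| <= `|x|.
Proof.
rewrite -(@ler_pXn2r _ 2)// ?nnegrE//.
have -> : `|x| ^+ 2 = \sum_i inner (x i) (x i) by exact: sqr_dirsum_norm.
rewrite (bigD1 l)//= -sqr_norm_inner lerDl.
by apply: sumr_ge0 => i _; exact: inner_ge0.
Qed.

Lemma near_coord x (P : forall l, H l -> Prop) :
  (forall l, \forall u \near x l, P l u) -> \forall z \near x, forall l, P l (z l).
Proof.
move=> xP.
refine (@filter_forall _ _ (fun l (z : dirsum H) => P l (z l)) (nbhs x) _ _) => l.
have /nbhs_distP[r r0 hr] := xP l; apply/nbhs_distP; exists r => // z zx.
by apply: hr; apply: le_lt_trans zx; exact: (norm_coord (z - x)).
Qed.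

Lemma frechet_subdiff_separable (h : forall l, H l -> \bar R) x v :
  (forall l, frechet_subdiff (h l) (x l) (v l)) ->
  frechet_subdiff (fun z : dirsum H => \sum_l h l (z l))%E x v.
Proof.
move=> hx; split.
  by rewrite sum_fin_num; apply/allP => _ /mapP[l _ ->]; case: (hx l).
(* Each block gets an equal share of e; L + 1 rather than L allows L = 0. *)
move=> e e0; have e'0 : 0 < e / L.+1%:R by rewrite divr_gt0.
have := near_coord (fun l => (hx l).2 _ e'0).
apply: filterS => z hz.
apply: le_trans (lee_sum _ (fun l _ => hz l)).
rewrite (eq_bigr (fun l => (fine (h l (x l)))%:E)); last first.
  by move=> l _; rewrite fineK//; case: (hx l).
under [X in (_ <= X)%E]eq_bigr => l _.
  rewrite -[h l (x l)](fineK (hx l).1) -EFinD; over.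
rewrite !sumEFin -EFinD lee_fin big_split/= lerD2l.
rewrite [inner _ _]/= /dirsum_inner.
rewrite [X in _ <= X]sumrB lerD2l// lerN2 -mulr_sumr.
rewrite -mulrA ler_wpM2l ?(ltW e0)// ler_pdivrMl//.
have le_zx : \sum_l `|z l - x l| <= \sum_(l < L) `|(z : dirsum H) - x|.
  by apply: ler_sum => l _; exact: (norm_coord ((z : dirsum H) - x)).
apply: le_trans le_zx _.
by rewrite sumr_const card_ord -[X in X <= _]mulr_natl ler_wpM2r// ler_nat.
Qed.

Section Objective.
Variables (f : dirsum H -> R) (phi : 'I_L -> \bar R -> \bar R).
Variable psi : forall l, H l -> \bar R.
Arguments psi : clear implicits.
Hypotheses (df : forall x, differentiable f x).
Hypotheses (phi_reg : forall l, phi_regular (phi l)).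
Hypotheses (psi_reg : forall l, psi_regular (psi l)).

(** This may be smaller than [edom] of the objective, since phi_l(+oo) may be finite. The iterates
    and their cluster points stay in it. *)
Definition psi_dom : set (dirsum H) := [set z | forall l, edom (psi l) (z l)].

(** A real-valued Psi, faithful on [psi_dom]; elsewhere [fine] replaces +oo by 0. *)
Definition fobj (z : dirsum H) : R :=
  f z + \sum_l fine (phi l (fine (psi l (z l)))%:E).

Lemma objectiveE z : psi_dom z -> objective f phi psi z = (fobj z)%:E.
Proof.
move=> zd; rewrite /objective /regularizer /fobj EFinD -sumEFin; congr (_ + _)%E.
by apply: eq_bigr => l _; rewrite (phi_psi_fin (phi_reg l) (psi_reg l)).
Qed.

Lemma objective_frechet_subdiff z v : (forall l, subdiff (psi l) (z l) (v l)) ->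
  frechet_subdiff (objective f phi psi) z
    (grad f z + (fun l => dphi (phi l) (fine (psi l (z l))) *: v l) : dirsum H).
Proof.
move=> zv; apply: frechet_subdiffD_differentiable => //.
apply: (@frechet_subdiff_separable (fun l u => phi l (psi l u))) => l.
exact: (frechet_subdiff_comp (phi_reg l) (psi_reg l) (zv l)).
Qed.

Lemma fobj_continuous z : psi_dom z -> forall e : R, 0 < e ->
  \forall y \near z, psi_dom y -> `|fobj y - fobj z| <= e.
Proof.
(* One share of e for f and one for each of the L blocks. *)
move=> zd e e0; have e'0 : 0 < e / L.+1%:R by rewrite divr_gt0.
have fc : \forall y \near z, `|f y - f z| <= e / L.+1%:R.
  have /cvgrPdist_le/(_ _ e'0) := differentiable_continuous (df z).
  by apply: filterS => y; rewrite distrC.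
have := near_coord (fun l => phi_psi_continuous (phi_reg l) (psi_reg l) (zd l) e'0).
apply: filterS2 fc => y fy hy yd.
rewrite /fobj opprD addrACA -sumrB (le_trans (ler_normD _ _))//.
apply: le_trans (lerD fy (ler_norm_sum _ _ _)) _.
apply: le_trans (lerD (lexx _) (ler_sum _ (fun l _ => hy l (yd l)))) _.
rewrite sumr_const card_ord -[X in _ + X]mulr_natl.
by rewrite -[X in X + _]mul1r -mulrDl nat1r mulrCA divff ?mulr1.
Qed.

Lemma psi_dom_closed z :
  (forall r : R, 0 < r -> exists2 y, psi_dom y & `|y - z| < r) -> psi_dom z.
Proof.
move=> hz l; apply: edom_closed => // r r0; have [y yd yz] := hz r r0.
by exists (y l); [exact: yd|apply: le_lt_trans yz; exact: (norm_coord (y - z))].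
Qed.

End Objective.
End DirectSumSubgradients.

(** * Lipschitz and convergence estimates *)

Section FiniteLength.
Context {R : realType} {V : normedModType R}.
Variables (x : nat -> V) (S : nat -> R).
Hypothesis step : forall k, `|x k.+1 - x k| <= S k.

Lemma norm_telescope m n : (m <= n)%N ->
  `|x n - x m| <= \sum_(m <= i < n) S i.
Proof.
move=> mn; rewrite -telescope_sumr// (le_trans (ler_norm_sum _ _ _))//.
by apply: ler_sum => i _.
Qed.

(** Past an N whose partial sum is within e / 2 of the supremum, the remaining path is shorter than
    e / 2; after a visit within e / 2 of xhat the sequence stays within e. *)
Lemma finite_length_cvg xhat B : (forall n, \sum_(k < n) S k <= B) ->
  (forall (e : R) N, 0 < e -> exists2 k, (N <= k)%N & `|x k - xhat| < e) ->
  x @ \oo --> xhat.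
Proof.
move=> SB rec.
pose P := [set \sum_(k < n) S k | n in [set: nat]].
have supP : has_sup P.
  split; first by exists (\sum_(k < 0) S k), 0%N.
  by exists B => _ [n _ <-].
apply/cvgrPdist_le => e e0; have e20 : 0 < e / 2 by rewrite divr_gt0.
have [_ [N _ <-] hN] := sup_adherent e20 supP.
have [m Nm xm] := rec (e / 2) N e20.
exists m => // k /= mk; rewrite distrC.
apply: le_trans (ler_distD (x m) _ _) _.
have := norm_telescope mk; have S_ge0 i : 0 <= S i by exact: le_trans (step i).
have kP : \sum_(i < k) S i <= sup P by apply: ub_le_sup; [exact: supP.2|exists k].
have : \sum_(m <= i < k) S i + \sum_(i < N) S i <= \sum_(i < k) S i.
  rewrite -!(big_mkord xpredT S).
  have -> : \sum_(0 <= i < k) S i = \sum_(0 <= i < m) S i + \sum_(m <= i < k) S i.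
    exact: big_cat_nat.
  have -> : \sum_(0 <= i < m) S i = \sum_(0 <= i < N) S i + \sum_(N <= i < m) S i.
    exact: big_cat_nat.
  by rewrite addrC lerD2r lerDl sumr_ge0.
lra.
Qed.

End FiniteLength.

(** Cauchy-Schwarz against the constant vector; the induction step rests on (s - m b)^2 >= 0. *)
Lemma sqr_sum_le {R : realFieldType} (a : nat -> R) n :
  (\sum_(i < n) a i) ^+ 2 <= n%:R * \sum_(i < n) a i ^+ 2.
Proof.
elim: n => [|n IH]; first by rewrite !big_ord0 mul0r expr0n.
case: n IH => [|n] IH; first by rewrite !big_ord1 mul1r.
rewrite big_ord_recr [X in _ <= _ * X]big_ord_recr/= -[n.+2%:R]natr1.
set s := \sum_(i < n.+1) a i in IH *; set q := \sum_(i < n.+1) _ in IH *.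
set m : R := n.+1%:R in IH *; have m0 : 0 < m by rewrite ltr0n.
set b := a n.+1.
have := sqr_ge0 (s - m * b) => h.
have : 2 * s * b <= q + m * b ^+ 2 by rewrite -(ler_pM2l m0); nra.
nra.
Qed.

Section DirectSumBounds.
Context {R : realType} {L : nat} {H : 'I_L -> finHilbertType R}.
Implicit Types (x y z w : dirsum H).

Lemma norm_le_sum_coord w : `|w| <= \sum_l `|w l|.
Proof.
have s0 : 0 <= \sum_l `|w l| by apply: sumr_ge0.
rewrite -(@ler_pXn2r _ 2)// ?nnegrE//.
have -> : `|w| ^+ 2 = \sum_i inner (w i) (w i) by exact: sqr_dirsum_norm.
rewrite [X in _ <= X]expr2 mulr_suml; apply: ler_sum => l _.
rewrite -sqr_norm_inner expr2 ler_wpM2l//.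
by rewrite (bigD1 l)//= lerDl sumr_ge0.
Qed.

(** The hypothesis controls changes of a single block, so y is turned into x one block at a time:
    [z m] has its first m blocks from x, and each of the L moves costs at most B |x - y|. *)
Lemma grad_lipschitz (f : dirsum H -> R) : block_lipschitz f ->
  exists2 C : R, 0 <= C &
    forall x y l, `|grad f x l - grad f y l| <= C * `|x - y|.
Proof.
move=> flip.
have betaP l : exists b : 'I_L -> R, forall j, 0 < b j /\ forall (x : dirsum H) (v : H j),
    `|grad f (x + block v) l - grad f x l| <= b j * `|v|.
  have /choice[b bP] : forall j, exists b : R, 0 < b /\ forall (x : dirsum H) (v : H j),
      `|grad f (x + block v) l - grad f x l| <= b * `|v|.
    by move=> j; have [b b0 hb] := flip l j; exists b.
  by exists b.
have [b bP] := choice betaP.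
pose B := \sum_l \sum_j b l j.
have b_ge0 l j : 0 <= b l j by rewrite ltW//; case: (bP l j).
have bB l j : b l j <= B.
  rewrite /B (bigD1 l)//= (bigD1 j)//= -addrA lerDl addr_ge0 ?sumr_ge0// => i _.
  by apply: sumr_ge0 => ? _.
have B0 : 0 <= B by apply: sumr_ge0 => i _; apply: sumr_ge0.
exists (L%:R * B); first by rewrite mulr_ge0.
move=> x y l.
pose z m : dirsum H := fun j => if (j < m)%N then x j else y j.
have zL : z L = x by apply: functional_extensionality_dep => j; rewrite /z ltn_ord.
have z0 : z 0%N = y by apply: functional_extensionality_dep => j.
have main m : (m <= L)%N -> `|grad f (z m) l - grad f y l| <= m%:R * B * `|x - y|.
  elim: m => [|m IH] mL; first by rewrite z0 subrr normr0 !mul0r.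
  pose j := Ordinal mL.
  have -> : z m.+1 = z m + block (x j - y j).
    apply: functional_extensionality_dep => i.
    rewrite [in RHS]/GRing.add/= /dirsum_add /block.
    have [->|ij] := eqVneq i j.
      by rewrite dfwithin /z/= ltnSn ltnn addrC subrK.
    rewrite dfwithout 1?eq_sym// addr0 /z ltnS leq_eqVlt.
    by move: ij; rewrite -val_eqE/= => /negPf ->.
  apply: le_trans (ler_distD (grad f (z m) l) _ _) _.
  apply: le_trans (lerD ((bP l j).2 _ _) (IH (ltnW mL))) _.
  rewrite -natr1 2!mulrDl mul1r [leRHS]addrC lerD2r.
  by apply: ler_pM => //; exact: (norm_coord (x - y)).
by rewrite -{1}zL; exact: main.
Qed.

End DirectSumBounds.

(** The derivative of phi is locally Lipschitz and positive at psi(xhat), and psi is Lipschitz on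
    its domain; both properties pass to the composite near xhat. *)
Lemma dphi_psi_local {R : realType} {V : finHilbertType R} (phi : \bar R -> \bar R)
    (psi : V -> \bar R) (xhat : V) :
  phi_regular phi -> psi_regular psi -> edom psi xhat ->
  exists r m K : R, [/\ 0 < r, 0 < m, 0 < K &
    forall z z', edom psi z -> edom psi z' ->
      `|z - xhat| < r -> `|z' - xhat| < r ->
      m <= dphi phi (fine (psi z)) /\
      `|dphi phi (fine (psi z)) - dphi phi (fine (psi z'))| <= K * `|z - z'|].
Proof.
move=> phi_reg psi_reg xd; have p0 := fine_psi_ge0 psi_reg.
have [_ _ _ _ /lipschitz_constant[k k0 lip]] := psi_reg.
have t0 := p0 xhat; set t := fine (psi xhat) in t0 *.
have [_ _ _ _ /(_ t t0)[e e0 /lipschitz_constant[q q0 dlip]]] := phi_reg.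
have d0 := dphi_gt0 phi_reg t0; set d := dphi phi t in d0 *.
(* Below e the Lipschitz constant q is valid; below d / (2 q) the slope varies by at most d / 2. *)
pose e' := Num.min e (d / (2 * q)).
have e'0 : 0 < e' by rewrite lt_min e0 divr_gt0// mulr_gt0.
exists (e' / k), (d / 2), (q * k); split; rewrite ?divr_gt0 ?mulr_gt0//.
move=> z z' zd z'd zr z'r.
have near u : edom psi u -> `|u - xhat| < e' / k ->
    `|fine (psi u) - t| < e /\ q * `|fine (psi u) - t| <= d / 2.
  move=> ud; rewrite ltr_pdivlMr// => ur.
  have : `|fine (psi u) - t| < e'.
    by apply: le_lt_trans (lip _ _ ud xd) _; rewrite mulrC.
  rewrite lt_min ltr_pdivlMr ?mulr_gt0// => /andP[-> h]; split=> //; lra.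
have inb u : edom psi u -> `|u - xhat| < e' / k ->
    ([set s : R | 0 <= s] `&` ball t e) (fine (psi u)).
  by move=> ud ur; split; [exact: p0|rewrite /ball/= distrC (near u ud ur).1].
have tb : ([set s : R | 0 <= s] `&` ball t e) t by split => //; exact: ballxx.
split.
  have := dlip _ _ (inb z zd zr) tb; rewrite ler_norml -/d => /andP[h _].
  have [_] := near z zd zr; lra.
apply: le_trans (dlip _ _ (inb _ zd zr) (inb _ z'd z'r)) _.
by rewrite -mulrA ler_wpM2l ?(ltW q0)//; exact: lip.
Qed.

(** * Iterates of CO-BC-FB *)

Section CoBcFbAnalysis.
Context {R : realType} {L : nat} {H : 'I_L -> finHilbertType R}.
Variables (f : dirsum H -> R) (phi : 'I_L -> \bar R -> \bar R).
Variable psi : forall l, H l -> \bar R.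
Arguments psi : clear implicits.
Variables (A : @majorant_ops R L H) (delta mu : R) (I : nat -> nat).
Variables (J : nat -> nat -> {set 'I_L}) (x : nat -> dirsum H).
Variable xt : nat -> nat -> dirsum H.
Hypotheses (f_C1 : C1 f) (f_lip : block_lipschitz f).
Hypotheses (psi_reg : forall l, psi_regular (psi l)).
Hypotheses (phi_reg : forall l, phi_regular (phi l)).
Hypotheses (f_maj : quad_majorization f A) (delta_gt0 : 0 < delta) (mu_gt0 : 0 < mu).
Hypothesis algo : CO_BC_FB f phi psi A delta mu I J x xt.
Hypothesis all_updated : forall k, (\bigcup_(i < I k) J k i)%SET = [set: 'I_L]%SET.
Variable Imax : nat.
Hypothesis I_bounded : forall k, (0 < I k <= Imax)%N.

Let lam k l : R := dphi (phi l) (fine (psi l (x k l))).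

Definition inner_length k : R := \sum_(i < I k) `|xt k i.+1 - xt k i|.

Let xt0 k : xt k 0%N = x k. Proof. by case: algo => _ _ /(_ k)[]. Qed.
Let xtI k : xt k (I k) = x k.+1. Proof. by case: algo => _ _ /(_ k)[]. Qed.

Let updatedP k i l : (i < I k)%N -> l \in J k i ->
  block_update f (psi l) delta mu (lam k l) (A (xt k i) (J k i) l) (xt k i) (xt k i.+1).
Proof. by case: algo => _ _ _ h ik lJ; have := h k i ik l; rewrite lJ. Qed.

Let not_updatedP k i l : (i < I k)%N -> l \notin J k i -> xt k i.+1 l = xt k i l.
Proof. by case: algo => _ _ _ h ik /negPf lJ; have := h k i ik l; rewrite lJ. Qed.

(** An updated block carries a subgradient of psi_l, which exists only where psi_l is finite; the
    other blocks are inherited. *)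
Lemma inner_iterates_dom k i : (i <= I k)%N -> psi_dom psi (xt k i).
Proof.
have inner_dom m : psi_dom psi (x m) -> forall i, (i <= I m)%N -> psi_dom psi (xt m i).
  move=> xm; elim=> [|j IH] jI; first by rewrite xt0.
  move=> l; have [lJ|lJ] := boolP (l \in J m j).
    have [al [v [_ [fx _] _ _]]] := updatedP jI lJ.
    by move: fx; rewrite fin_numElt => /andP[].
  by rewrite (not_updatedP jI lJ); exact: IH (ltnW jI) l.
suff : psi_dom psi (x k) by move=> /inner_dom; apply.
elim: k => [|k IH]; first by case: algo => _ + _ _.
by rewrite -xtI; exact: inner_dom.
Qed.

Lemma outer_iterates_dom k : psi_dom psi (x k).
Proof. by rewrite -xt0; exact: inner_iterates_dom. Qed.

Lemma norm_inner_iterates k m n : (m <= n)%N -> (n <= I k)%N ->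
  `|xt k n - xt k m| <= inner_length k.
Proof.
move=> mn nI; apply: le_trans (norm_telescope (fun i => lexx _) mn) _.
rewrite /inner_length -(big_mkord xpredT (fun i => `|xt k i.+1 - xt k i|)).
have -> : \sum_(0 <= i < I k) `|xt k i.+1 - xt k i| =
    \sum_(0 <= i < m) `|xt k i.+1 - xt k i| +
    (\sum_(m <= i < n) `|xt k i.+1 - xt k i| + \sum_(n <= i < I k) `|xt k i.+1 - xt k i|).
  by rewrite -!big_cat_nat// (leq_trans mn).
by rewrite addrCA lerDl addr_ge0 ?sumr_ge0.
Qed.

Lemma outer_step k : `|x k.+1 - x k| <= inner_length k.
Proof. by rewrite -xtI -xt0; exact: norm_inner_iterates. Qed.

(** Up to a constant depending on k, Psi with each phi_l replaced by its tangent at psi_l(x^k_l). *)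
Let majorizer k z : R := f z + \sum_l lam k l * fine (psi l (z l)).

(** The majorization spends 1/2 of the squared A-norm of each block step, the update rule gains at
    least 1/2 + delta of it, and A dominates [lo] times the identity. *)
Lemma inner_descent : exists2 c : R, 0 < c & forall k i, (i < I k)%N ->
  majorizer k (xt k i.+1) + c * `|xt k i.+1 - xt k i| ^+ 2 <= majorizer k (xt k i).
Proof.
have [lo [hi [lo0 hi0 maj]]] := f_maj.
exists (delta * lo); first by rewrite mulr_gt0.
move=> k i ik; set y := xt k i; set z := xt k i.+1.
have [spd fmaj] := maj y (J k i).
(* Blocks outside J did not move, so the majorization applies to the new iterate itself. *)
have zmix : mix (J k i) z y = z.
  apply: functional_extensionality_dep => l; rewrite /mix; case: ifPn => // lJ.
  by rewrite /z not_updatedP.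
have := fmaj z; rewrite zmix big_mkcond/= => fz.
have -> : `|z - y| ^+ 2 = \sum_l `|z l - y l| ^+ 2.
  rewrite [LHS](sqr_dirsum_norm (z - y)).
  by apply: eq_bigr => l _; rewrite sqr_norm_inner.
rewrite /majorizer.
suff : \sum_l ((if l \in J k i then inner (z l - y l) (grad f y l) +
      2^-1 * sqnorm (A y (J k i) l) (z l - y l) else 0) +
      delta * lo * `|z l - y l| ^+ 2 + lam k l * fine (psi l (z l)))
    <= \sum_l lam k l * fine (psi l (y l)).
  rewrite !big_split/= -mulr_sumr; lra.
apply: ler_sum => l _; case: ifPn => lJ; last first.
  by rewrite /z not_updatedP// subrr normr0 expr0n mulr0 !add0r.
have [al [v [hal _ ineq _]]] := updatedP ik lJ.
have [_ /(_ (z l - y l))/andP[q1 _]] := spd l lJ.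
have fz' := psi_regular_fin (psi_reg l) (inner_iterates_dom ik l).
have fy' := psi_regular_fin (psi_reg l) (inner_iterates_dom (ltnW ik) l).
move: ineq; rewrite -(fineK fz') -(fineK fy') -!EFinM -EFinD lee_fin.
rewrite -/y -/z innerC; set q := sqnorm _ _ in q1 *.
have q0 : 0 <= q by apply: le_trans q1; rewrite mulr_ge0 ?sqr_ge0// ltW.
have : delta * (lo * `|z l - y l| ^+ 2) <= delta * q by rewrite ler_pM2l.
have : (2^-1 + delta) * q <= al * q by rewrite ler_wpM2r.
rewrite /lam; lra.
Qed.

(** Inner decreases telescope, and Cauchy-Schwarz over at most Imax steps turns the sum of squares
    into the square of the path length. *)
Lemma outer_descent : exists2 c : R, 0 < c &
  forall k, c * inner_length k ^+ 2 <= fobj f phi psi (x k) - fobj f phi psi (x k.+1).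
Proof.
have [c c0 hc] := inner_descent.
have Imax0 : 0 < Imax%:R :> R.
  by have /andP[h1 h2] := I_bounded 0%N; rewrite ltr0n (leq_trans h1).
exists (c / Imax%:R); first by rewrite divr_gt0.
move=> k.
have tele n : (n <= I k)%N -> majorizer k (xt k n) +
    c * \sum_(i < n) `|xt k i.+1 - xt k i| ^+ 2 <= majorizer k (x k).
  elim: n => [|n IH] nI; first by rewrite big_ord0 mulr0 addr0 xt0.
  by rewrite big_ord_recr/= mulrDr; have := IH (ltnW nI); have := hc k n nI; lra.
have := tele _ (leqnn _); rewrite xtI => tI.
have : c / Imax%:R * inner_length k ^+ 2 <= c * \sum_(i < I k) `|xt k i.+1 - xt k i| ^+ 2.
  rewrite -mulrA ler_pM2l// ler_pdivrMl//.
  apply: le_trans (sqr_sum_le (fun i => `|xt k i.+1 - xt k i|) (I k)) _.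
  apply: ler_wpM2r; first by apply: sumr_ge0 => i _; exact: sqr_ge0.
  by rewrite ler_nat; case/andP: (I_bounded k).
(* The tangent inequality at psi_l(x^k_l) transfers the decrease from the majorizer to Psi. *)
have : \sum_l fine (phi l (fine (psi l (x k.+1 l)))%:E) +
       \sum_l lam k l * fine (psi l (x k l)) <=
       \sum_l fine (phi l (fine (psi l (x k l)))%:E) +
       \sum_l lam k l * fine (psi l (x k.+1 l)).
  rewrite -!big_split/=; apply: ler_sum => l _.
  have := phi_le_tangent (phi_reg l) (fine_psi_ge0 (psi_reg l) (x k.+1 l))
    (fine_psi_ge0 (psi_reg l) (x k l)).
  rewrite -/(lam k l); lra.
move: tI; rewrite /majorizer /fobj; lra.
Qed.

(** Block l of x^(k+1) was produced by its last update, so the optimality condition of that update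
    concerns x^(k+1). *)
Lemma last_update k l : exists i, [/\ (i < I k)%N, l \in J k i & x k.+1 l = xt k i.+1 l].
Proof.
have ex n : (n <= I k)%N -> (exists2 i, (i < n)%N & l \in J k i) ->
    exists i, [/\ (i < n)%N, l \in J k i & xt k n l = xt k i.+1 l].
  elim: n => [|n IH] nI [i ilt lJ] //.
  have [lJn|lJn] := boolP (l \in J k n); first by exists n.
  have iltn : (i < n)%N.
    by move: ilt lJ; rewrite ltnS leq_eqVlt => /predU1P[->|//]; rewrite (negPf lJn).
  have [|j [jn lJj e]] := IH (ltnW nI); first by exists i.
  by exists j; split; [exact: ltnW|exact: lJj|rewrite (not_updatedP nI lJn)].
rewrite -xtI; apply: ex => //.
have : l \in (\bigcup_(i < I k) J k i)%SET by rewrite all_updated inE.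
by move=> /bigcupP[i _ lJ]; exists i.
Qed.

(** The condition at the last update has an old gradient and the old slope; moving both to x^(k+1)
    costs Lipschitz terms, the second multiplied by |v|, which must be bounded. *)
Lemma block_subgradient_bound xhat l : psi_dom psi xhat ->
  exists r C : R, [/\ 0 < r, 0 <= C & forall k,
    `|x k - xhat| < r -> `|x k.+1 - xhat| < r -> inner_length k <= 1 ->
    exists2 v, subdiff (psi l) (x k.+1 l) v &
      `|grad f (x k.+1) l + lam k.+1 l *: v| <= C * inner_length k].
Proof.
move=> xd; have [Cf Cf0 gl] := grad_lipschitz f_lip.
have [lo [hi [lo0 hi0 maj]]] := f_maj.
have [r [m [K [r0 m0 K0 loc]]]] := dphi_psi_local (phi_reg l) (psi_reg l) (xd l).
pose M := mu * Num.sqrt hi; have M0 : 0 <= M by rewrite mulr_ge0 ?sqrtr_ge0// ltW.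
(* The inner iterates are within 2 of xhat: 1 from the radius and 1 from the inner path. *)
pose G := `|grad f xhat l| + 2 * Cf.
(* With slopes at least m, m |v| <= |lam v| <= G + M. *)
pose Vb := (G + M) / m.
exists (Num.min r 1), (Cf + M + K * Vb).
have G0 : 0 <= G by rewrite addr_ge0 ?mulr_ge0.
have Vb0 : 0 <= Vb by apply: divr_ge0; [exact: addr_ge0|exact: ltW].
split; first by rewrite lt_min r0 ltr01.
  by apply: addr_ge0; [exact: addr_ge0|apply: mulr_ge0 => //; exact: ltW].
move=> k; rewrite !lt_min => /andP[xr x1] /andP[xr' _] S1.
have [i [ik lJ xi]] := last_update k l.
have [al [v [_ sub _ vb]]] := updatedP ik lJ.
rewrite -xi in sub; exists v => //.
have S0 : 0 <= inner_length k by apply: sumr_ge0.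
have dS : `|xt k i.+1 l - xt k i l| <= inner_length k.
  apply: le_trans (norm_coord (xt k i.+1 - xt k i) l) _.
  exact: norm_inner_iterates.
have vM : `|grad f (xt k i) l + lam k l *: v| <= M * inner_length k.
  apply: le_trans vb _; rewrite -mulrA ler_wpM2l ?(ltW mu_gt0)//.
  have [spd _] := maj (xt k i) (J k i); have [_ sp] := spd l lJ.
  have := sp (xt k i.+1 l - xt k i l) => /andP[_ q2].
  apply: le_trans (ler_wsqrtr q2) _.
  rewrite sqrtrM ?(ltW hi0)// sqrtr_sqr normr_id ler_wpM2l ?sqrtr_ge0//.
have coordr z : `|z - xhat| < r -> `|z l - xhat l| < r.
  by apply: le_lt_trans; exact: (norm_coord (z - xhat)).
have [lm lK] := loc _ _ (outer_iterates_dom k l) (outer_iterates_dom k.+1 l)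
  (coordr _ xr) (coordr _ xr').
rewrite -/(lam k l) -/(lam k.+1 l) in lm lK.
have gy : `|grad f (xt k i) l| <= G.
  have xt2 : `|xt k i - xhat| <= 2.
    apply: le_trans (ler_distD (x k) _ _) _; rewrite -[X in _ <= X]natr1.
    apply: lerD; last exact: ltW.
    by have := norm_inner_iterates (leq0n i) (ltnW ik); rewrite xt0 => /le_trans; apply.
  rewrite /G -lerBlDl; apply: le_trans (lerB_dist _ _) _.
  by apply: le_trans (gl _ _ _) _; rewrite mulrC ler_wpM2r.
have vV : `|v| <= Vb.
  rewrite /Vb ler_pdivlMr// mulrC.
  have mlv : m * `|v| <= `|lam k l *: v|.
    by rewrite normrZ ler_wpM2r//; exact: le_trans lm (ler_norm _).
  apply: le_trans mlv _; rewrite -[X in `|X|](addKr (grad f (xt k i) l)).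
  apply: le_trans (ler_normD _ _) _; rewrite normrN lerD//.
  by apply: le_trans vM _; exact: ler_piMr.
(* Gradient change, inexact optimality and slope change, bounded by Cf, M and K Vb times the inner
   length. *)
have -> : grad f (x k.+1) l + lam k.+1 l *: v =
    (grad f (x k.+1) l - grad f (xt k i) l) + (grad f (xt k i) l + lam k l *: v)
    + (lam k.+1 l - lam k l) *: v.
  by rewrite addrA subrK scalerBl -addrA (addrC (_ *: _) (_ - _)) subrK.
apply: le_trans (ler_normD _ _) _; rewrite 2!mulrDl lerD//.
  apply: le_trans (ler_normD _ _) _; rewrite lerD//.
  apply: le_trans (gl _ _ _) _; rewrite ler_wpM2l// -xtI.
  exact: norm_inner_iterates (ltnW ik) (leqnn _).
rewrite normrZ distrC mulrAC; apply: ler_pM => //.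
apply: le_trans lK _; rewrite ler_wpM2l ?(ltW K0)// distrC.
by apply: le_trans (norm_coord (x k.+1 - x k) l) _; exact: outer_step.
Qed.

Lemma subgradient_bound xhat : psi_dom psi xhat ->
  exists r C : R, [/\ 0 < r, 0 <= C & forall k,
    `|x k - xhat| < r -> `|x k.+1 - xhat| < r -> inner_length k <= 1 ->
    exists2 w, frechet_subdiff (objective f phi psi) (x k.+1) w &
      `|w| <= C * inner_length k].
Proof.
move=> xd.
have /choice[rC rCP] : forall l, exists rC : R * R, [/\ 0 < rC.1, 0 <= rC.2 & forall k,
    `|x k - xhat| < rC.1 -> `|x k.+1 - xhat| < rC.1 -> inner_length k <= 1 ->
    exists2 v, subdiff (psi l) (x k.+1 l) v &
      `|grad f (x k.+1) l + lam k.+1 l *: v| <= rC.2 * inner_length k].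
  by move=> l; have [r [C h]] := block_subgradient_bound l xd; exists (r, C).
(* The initial value 1 keeps the radius positive even for L = 0. *)
exists (\big[Num.min/1]_l (rC l).1), (\sum_l (rC l).2); split.
- by apply: lt_bigmin => // l _; case: (rCP l).
- by apply: sumr_ge0 => l _; case: (rCP l).
move=> k xr xr' S1.
have vex l : exists v, subdiff (psi l) (x k.+1 l) v /\
    `|grad f (x k.+1) l + lam k.+1 l *: v| <= (rC l).2 * inner_length k.
  have [_ _ /(_ k)] := rCP l.
  have le_r : \big[Num.min/1]_l0 (rC l0).1 <= (rC l).1 by exact: bigmin_le.
  move=> /(_ (lt_le_trans xr le_r) (lt_le_trans xr' le_r) S1)[v v1 v2].
  by exists v.
pose v : dirsum H := fun l => projT1 (cid (vex l)).
have vP l : subdiff (psi l) (x k.+1 l) (v l) /\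
    `|grad f (x k.+1) l + lam k.+1 l *: v l| <= (rC l).2 * inner_length k.
  exact: projT2 (cid (vex l)).
exists (grad f (x k.+1) + (fun l => lam k.+1 l *: v l) : dirsum H).
  by apply: objective_frechet_subdiff => // [y|l]; [exact: f_C1.1|exact: (vP l).1].
apply: le_trans (norm_le_sum_coord _) _; rewrite mulr_suml.
by apply: ler_sum => l _; exact: (vP l).2.
Qed.

End CoBcFbAnalysis.

(** * Finite length and convergence to a critical point *)

Lemma frechet_subdiff_sub {R : realType} {V : finHilbertType R} (h : V -> \bar R) x :
  frechet_subdiff h x `<=` subdiff h x.
Proof.
move=> v hv; split; first by case: hv.
by exists (fun=> x), (fun=> v); split => //; exact: cvg_cst.
Qed.

Lemma dist0_le_norm {R : realType} {V : finHilbertType R} (B : set V) v :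
  B v -> (dist0 B <= `|v|%:E)%E.
Proof. by move=> Bv; apply: ereal_inf_lbound; exists v. Qed.

Theorem theorem8 (R : realType) (L : nat) (H : 'I_L -> finHilbertType R)
    (f : dirsum H -> R) (phi : 'I_L -> \bar R -> \bar R)
    (psi : forall l, H l -> \bar R) (A : @majorant_ops R L H)
    (delta mu : R) (I : nat -> nat) (J : nat -> nat -> {set 'I_L})
    (x : nat -> dirsum H) (xt : nat -> nat -> dirsum H)
    (f_C1 : C1 f) (f_lip : block_lipschitz f)
    (psi_reg : forall l, psi_regular (psi l))
    (phi_reg : forall l, phi_regular (phi l))
    (f_maj : quad_majorization f A)
    (delta_gt0 : 0 < delta) (mu_gt0 : 0 < mu)
    (algo : CO_BC_FB f phi psi A delta mu I J x xt)
    (all_updated : forall k, (\bigcup_(i < I k) J k i)%SET = [set: 'I_L]%SET)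
    (I_bounded : exists2 Imax : nat, (0 < Imax)%N &
       forall k, (0 < I k <= Imax)%N)
    (Psi_lbound : exists m : R, forall u, (m%:E <= objective f phi psi u)%E)
    (iterates_bounded : exists M : R, forall k i, (i <= I k)%N -> `|xt k i| <= M)
    (KL : forall u, edom (objective f phi psi) u -> KL_at (objective f phi psi) u) :
  (\sum_(0 <= k <oo) `|x k.+1 - x k|%:E < +oo)%E /\
  exists2 xhat : dirsum H, x @ \oo --> xhat &
    subdiff (objective f phi psi) xhat 0.
Proof.
have [Imax _ Ib] := I_bounded.
have xdom := outer_iterates_dom algo.
have step := outer_step algo.
have df : forall y, differentiable f y := f_C1.1.
have [M xM] : exists M, forall k, `|x k| <= M.
  have [M hM] := iterates_bounded; exists M => k.
  by case: algo => _ _ /(_ k)[<- _] _; exact: hM.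
have [xhat rec] := bounded_seq_recurrent xM.
have xhd : psi_dom psi xhat.
  apply: psi_dom_closed => // r r0; have [k _ xk] := rec r 0%N r0.
  by exists (x k) => //; exact: xdom.
pose F := fobj f phi psi.
have objE := objectiveE f phi_reg psi_reg.
have [c c0 desc] := outer_descent psi_reg phi_reg f_maj delta_gt0 algo Ib.
have [r1 [C [r10 C0 slope]]] :=
  subgradient_bound f_C1 f_lip psi_reg phi_reg f_maj mu_gt0 algo all_updated xhd.
have [eta [U [theta [eta0 /nbhs_distP[r2 r20 hU] des ineq]]]] : KL_at (objective f phi psi) xhat.
  by apply: KL; rewrite /edom/= objE// ltry.
pose S := inner_length I xt.
pose r k := F (x k) - F xhat.
(* Visits to xhat also bring the values close, by continuity of Psi relative to [psi_dom]. *)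
have recur (e : R) N : 0 < e ->
    exists2 k, (N <= k)%N & `|x k - xhat| < e /\ `|r k| < e.
  move=> e0; have e20 : 0 < e / 2 by rewrite divr_gt0.
  have /nbhs_distP[d d0 hd] := fobj_continuous df phi_reg psi_reg xhd e20.
  have [|k Nk] := rec (Num.min d e) N; first by rewrite lt_min d0.
  rewrite lt_min => /andP[xd xe]; exists k => //; split=> //.
  by apply: le_lt_trans (hd _ xd (xdom k)) _; rewrite ltr_pdivrMr// ltr_pMr// ltr1n.
have descr k : c * S k ^+ 2 <= r k - r k.+1.
  by apply: le_trans (desc k) _; rewrite /r opprB addrA subrK.
pose rho := Num.min r1 r2.
have rho0 : 0 < rho by rewrite lt_min r10.
have slope_r k : `|x k - xhat| < rho -> `|x k.+1 - xhat| < rho ->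
    S k <= 1 -> 0 < r k.+1 -> ((r k.+1)%:E < eta)%E ->
    1 <= derive1 theta (r k.+1) * (C * S k).
  rewrite !lt_min => /andP[x1 _] /andP[x1' x2'] S1 rk rke.
  (* The norm of w bounds dist(0, subdiff Psi(x^(k+1))) from above, so KL becomes a lower bound on
     S_k. *)
  have [w fw wS] := slope k x1 x1' S1.
  have := ineq _ (hU _ x2'); rewrite !objE// ?lte_fin -?EFinB ?fine_EFin/=.
  rewrite -subr_gt0 => /(_ rk).
  have -> : ((F (x k.+1))%:E < (F xhat)%:E + eta)%E.
    by rewrite -(subrK (F xhat) (F (x k.+1))) EFinD addeC lteD2lE.
  move=> /(_ isT).
  have th0 : 0 < derive1 theta (r k.+1) by case: des => _ _ _ _ /(_ _ rk rke)[].
  move=> /le_trans h; rewrite -lee_fin; apply: h; rewrite EFinM.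
  apply: lee_wpmul2l; first by rewrite lee_fin ltW.
  apply: le_trans (dist0_le_norm (frechet_subdiff_sub fw)) _.
  by rewrite lee_fin.
have [B SB] := kl_finite_length des eta0 c0 C0 rho0 step descr recur slope_r.
have xcvg : x @ \oo --> xhat := finite_length_cvg step SB rec.
split.
  apply: (@le_lt_trans _ _ B%:E); last exact: ltry.
  apply: lime_le; first by apply: is_cvg_nneseries.
  apply: nearW => n; rewrite sumEFin lee_fin big_mkord.
  by apply: le_trans (SB n); apply: ler_sum => k _; exact: step.
exists xhat => //.
have [N1 _ hN1] : \forall k \near \oo, `|x k - xhat| < r1.
  by have /cvgrPdist_lt/(_ r1 r10) := xcvg; apply: filterS => k; rewrite distrC.
have [N2 hN2] := kl_steps_small c0 step descr recur ltr01.
pose N := (N1 + N2)%N.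
(* These subgradients have norm at most C S_(N+n), which tends to 0; with the convergence of points
   and values they witness that 0 is a limiting subgradient at xhat. *)
have wex n : exists w, frechet_subdiff (objective f phi psi) (x (N + n).+1) w /\
    `|w| <= C * S (N + n)%N.
  have n1 : (N1 <= N + n)%N by rewrite -addnA leq_addr.
  have n2 : (N2 <= N + n)%N by rewrite addnAC leq_addl.
  have [w w1 w2] := slope _ (hN1 _ n1) (hN1 _ (leqW n1)) (ltW (hN2 _ n2)).
  by exists w.
have [w wP] := choice wex.
split; first by rewrite objE.
have ycvg : (fun n => x (N + n).+1) @ \oo --> xhat.
  have -> : (fun n => x (N + n).+1) = (fun n => x (n + N.+1)%N).
    by apply: funext => n; rewrite addnS addnC.
  by rewrite cvg_shiftn.
exists (fun n => x (N + n).+1), w; split => //; last by move=> n; exact: (wP n).1.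
- rewrite objE//; apply/fine_cvgP; split.
    by apply: nearW => n; rewrite objE.
  apply/cvgrPdist_le => e e0.
  have hF : \forall n \near \oo, psi_dom psi (x (N + n).+1) ->
      `|F (x (N + n).+1) - F xhat| <= e.
    exact: ycvg _ (fobj_continuous df phi_reg psi_reg xhd e0).
  by apply: filterS hF => n hn; rewrite /= objE//= distrC; exact: hn.
- apply/cvgrPdist_le => e e0.
  (* C may be 0, hence C + 1. *)
  have e'0 : 0 < e / (C + 1) by rewrite divr_gt0// ltr_wpDl.
  have [N3 hN3] := kl_steps_small c0 step descr recur e'0.
  exists N3 => // n /= n3; rewrite sub0r normrN.
  apply: le_trans (wP n).2 _.
  have : S (N + n)%N <= e / (C + 1) by apply/ltW/hN3; rewrite (leq_trans n3)// leq_addl.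
  move=> /(ler_wpM2l C0)/le_trans; apply.
  rewrite mulrA ler_pdivrMr ?ltr_wpDl//; nra.
Qed.
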